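(* Let $G$ be a connected, simply connected complex unipotent Lie group with Lie algebra $\mathfrak{g}$, and let $V,H\subset G$ be complex algebraic subgroups such that the $V\times H$-action on $G$ given by $(v,h).g=vgh^{-1}$ is free. If $\mathfrak{g}$ is $2$-step nilpotent, then there exists a global slice $S\subset G$ of the $V\times H$-action on $G$ that is algebraically isomorphic to $\mathbb{C}^{\dim G-\dim H-\dim V}$.
   Context: A complex unipotent Lie group is an algebraic subgroup of a group of (unipotent) upper triangular complex matrices. The descending central series is $\mathfrak{g}^{(0)}=\mathfrak{g}$, $\mathfrak{g}^{(j+1)}=[\mathfrak{g},\mathfrak{g}^{(j)}]$. A nilpotent Lie algebra $\mathfrak{g}$ is $l$-step nilpotent if $l$ is the smallest integer with $\mathfrak{g}^{(l)}=\{0\}$. A global slice of the $V\times H$-action on $G$ is a closed algebraic subvariety $S\subset G$ such that the map $V\times S\times H\to G$, $(v,s,h)\mapsto vsh$, is an isomorphism of algebraic varieties. *)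

(* Defs.v *)
(* [mpoly] is not imported: its notations clash with MathComp-Analysis. *)
From mathcomp Require Import all_boot all_order all_algebra.
From mathcomp Require Import complex.
From mathcomp Require Import boolp classical_sets set_interval reals.
From mathcomp Require Import topology normedtype.
From mathcomp Require mpoly.

Set Implicit Arguments.
Unset Strict Implicit.
Unset Printing Implicit Defensive.

Import Order.TTheory GRing.Theory Num.Theory.
Import numFieldNormedType.Exports.

Local Open Scope classical_set_scope.
Local Open Scope ring_scope.

Section AffineVarieties.
Variable F : fieldType.

(* A finite-dimensional vector space E is regarded as an affine space through
   the coordinates in [vbasis fullv]; another basis would give the same
   polynomial functions, closed sets and tangent spaces. *)
Definition coords (E : vectType F) (x : E) : 'I_(\dim {: E}) -> F :=
  fun i => coord (vbasis {: E}) i x.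

Definition peval (E : vectType F) (p : mpoly.mpoly (\dim {: E}) F) (x : E) : F :=
  mpoly.meval (coords x) p.

Definition zariski_closed (E : vectType F) (A : set E) : Prop :=
  exists I : set (mpoly.mpoly (\dim {: E}) F),
    A = [set x | forall p, I p -> peval p x = 0].

Definition regular_map (E E' : vectType F) (A : set E) (B : set E')
    (f : E -> E') : Prop :=
  (forall x, A x -> B (f x)) /\
  exists q : 'I_(\dim {: E'}) -> mpoly.mpoly (\dim {: E}) F,
    forall x, A x -> forall i, coords (f x) i = peval (q i) x.

Definition variety_isomorphism (E E' : vectType F) (A : set E) (B : set E')
    (f : E -> E') : Prop :=
  regular_map A B f /\
  exists g : E' -> E,
    [/\ regular_map B A g, forall x, A x -> g (f x) = x
      & forall y, B y -> f (g y) = y].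

Definition variety_isomorphic (E E' : vectType F) (A : set E) (B : set E') :
    Prop :=
  exists f : E -> E', variety_isomorphism A B f.

Definition vanishing_ideal (E : vectType F) (A : set E) :
    set (mpoly.mpoly (\dim {: E}) F) :=
  [set p | forall x, A x -> peval p x = 0].

Definition pdiff (E : vectType F) (p : mpoly.mpoly (\dim {: E}) F) (a X : E) : F :=
  \sum_i mpoly.meval (coords a) (mpoly.mderiv i p) * coords X i.

Definition tangent_vector (E : vectType F) (A : set E) (a X : E) : Prop :=
  forall p, vanishing_ideal A p -> pdiff p a X = 0.

(* The Zariski tangent space of A at a, as a bundled subspace: the unique one
   with the given members, see [tangent_spaceP]. *)
Definition tangent_space (E : vectType F) (A : set E) (a : E) : {vspace E} :=
  xget 0%VS [set U : {vspace E} | forall X, X \in U <-> tangent_vector A a X].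

Lemma vspace_of_pred (E : vectType F) (P : E -> Prop) :
    P 0 -> (forall (c : F) x y, P x -> P y -> P (c *: x + y)) ->
  exists U : {vspace E}, forall x, x \in U <-> P x.
Proof.
move=> P0 Plin.
pose Q (k : nat) :=
  `[< exists U : {vspace E}, \dim U = k /\ forall x, x \in U -> P x >].
have exQ : exists k, Q k.
  exists 0%N; apply/asboolP; exists 0%VS; split; first by rewrite dimv0.
  by move=> x; rewrite memv0 => /eqP ->.
have ubQ k : Q k -> (k <= \dim {: E})%N.
  by move=> /asboolP [U [<- _]]; apply/dimvS/subvf.
case: (ex_maxnP exQ ubQ) => k /asboolP [U [dU UP]] maxk.
exists U => x; split=> [/UP //|Px].
have /maxk : Q (\dim (<[x]> + U)%VS).
  apply/asboolP; exists (<[x]> + U)%VS; split=> // y.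
  by move=> /memv_addP [_ /vlineP [c ->]] [u /UP Pu ->]; apply: Plin.
rewrite -dU => le_dim.
have /eqP eqU : U == (<[x]> + U)%VS by rewrite eqEdim addvSr.
by rewrite eqU; apply: (subvP (addvSl _ _)); rewrite memv_line.
Qed.

Lemma tangent_spaceP (E : vectType F) (A : set E) (a X : E) :
  X \in tangent_space A a <-> tangent_vector A a X.
Proof.
rewrite /tangent_space.
case: xgetP => [U _ /= -> //|noU].
have [||U HU] := @vspace_of_pred E (tangent_vector A a).
- move=> p _; rewrite /pdiff big1 // => i _.
  by rewrite /coords linear0 mulr0.
- move=> c x y Hx Hy p Ap.
  have -> : pdiff p a (c *: x + y) = c * pdiff p a x + pdiff p a y.
    rewrite /pdiff mulr_sumr -big_split; apply: eq_bigr => i _ /=.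
    by rewrite /coords linearP mulrDr mulrCA.
  by rewrite Hx // Hy // mulr0 addr0.
by case: (noU U).
Qed.

End AffineVarieties.

Section MatrixGroups.
Variables (F : fieldType) (n : nat).

Definition matrix_group (G : set 'M[F]_n) : Prop :=
  [/\ G 1%:M, (forall A B, G A -> G B -> G (A *m B))
    & forall A, G A -> A \in unitmx /\ G (invmx A)].

Definition algebraic_group (G : set 'M[F]_n) : Prop :=
  matrix_group G /\ zariski_closed G.

(* [is_trig_mx] means lower triangular, hence the transpose. *)
Definition upper_unitriangular (A : 'M[F]_n) : Prop :=
  is_trig_mx A^T /\ forall i, A i i = 1.

Definition unipotent_group (G : set 'M[F]_n) : Prop :=
  algebraic_group G /\ forall A, G A -> upper_unitriangular A.

Definition lie_bracket (X Y : 'M[F]_n) : 'M[F]_n := X *m Y - Y *m X.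

(* The bracket being bilinear, brackets of basis elements span [U, W]. *)
Definition lie_prod (U W : {vspace 'M[F]_n}) : {vspace 'M[F]_n} :=
  <<[seq lie_bracket X Y | X <- vbasis U, Y <- vbasis W]>>%VS.

Definition descending_central_series (g : {vspace 'M[F]_n}) (j : nat) :
    {vspace 'M[F]_n} :=
  iter j (lie_prod g) g.

Definition step_nilpotent (l : nat) (g : {vspace 'M[F]_n}) : Prop :=
  descending_central_series g l = 0%VS /\
  forall j, (j < l)%N -> descending_central_series g j <> 0%VS.

(* The Lie algebra of G, with bracket [lie_bracket], is the tangent space at
   the identity; for a smooth variety, such as an algebraic group over a field
   of characteristic 0, its dimension is the dimension of the variety. *)
Definition lie_algebra (G : set 'M[F]_n) : {vspace 'M[F]_n} :=
  tangent_space G 1%:M.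

Definition group_dim (G : set 'M[F]_n) : nat := \dim (lie_algebra G).

Definition free_action (G V H : set 'M[F]_n) : Prop :=
  forall v h g, V v -> H h -> G g -> v *m g *m invmx h = g ->
    v = 1%:M /\ h = 1%:M.

Definition global_slice (G V H S : set 'M[F]_n) : Prop :=
  [/\ S `<=` G, zariski_closed S &
    variety_isomorphism (V `*` S `*` H) G
      (fun x : 'M[F]_n * 'M[F]_n * 'M[F]_n => x.1.1 *m x.1.2 *m x.2)].

End MatrixGroups.

Definition simply_connected (R : realType) (T : topologicalType) (A : set T) :
    Prop :=
  [/\ A !=set0,
      (forall x y, A x -> A y -> exists c : R -> T,
        [/\ {within `[0, 1], continuous c}, c @` `[0, 1] `<=` A, c 0 = x
          & c 1 = y]) &
      forall c : R -> T,
        {within `[0, 1], continuous c} -> c @` `[0, 1] `<=` A -> c 0 = c 1 ->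
        exists K : R * R -> T,
          [/\ {within `[0, 1] `*` `[0, 1], continuous K},
              K @` (`[0, 1] `*` `[0, 1]) `<=` A,
              (forall t, t \in `[0, 1] -> K (0, t) = c t /\ K (1, t) = c 0) &
              forall s, s \in `[0, 1] -> K (s, 0) = c 0 /\ K (s, 1) = c 0]].

(* Main.v *)
(* The exponential identifies G, V and H with their Lie algebras g, v and h, and,
   c = [g, g] being central, exp X exp Y = exp (X + Y + [X, Y] / 2) on g.
   Modulo c the group V x H acts by translations by v + h. What remains is the
   stabilizer of a point of g / c: it is parametrized by a space w lifting the
   intersection of the images of v and h, and over q it translates the fibre c
   (modulo its intersections with v and h) by T_q x = x - beta x + [x, q], where
   beta x in h lifts the class of x in v. Freeness says exactly that T_q is
   injective for every q. As T_q is affine in q, the Quillen-Suslin theorem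
   completes its matrix to an invertible polynomial matrix; the complement of
   the image of T_q so obtained, for q in a complement m of v + h + c in g, is
   the slice, and it is parametrized by m x F^k.

   Quillen-Suslin is proved for rows without common zero over F[q_1, ..., q_m],
   by induction on m. After a change of variables an entry f_0 is monic in the
   last variable t; the resultants b_k of f_0 with finitely many combinations of
   the other entries have no common zero, so that 1 = sum_k a_k b_k by
   induction; and by Suslin's lemma the rows f(t) and f(t + e b_k) are
   equivalent, so f(t) is equivalent to f(0). *)
From HB Require Import structures.
Require Import Defs.
From mathcomp Require Import all_boot all_order all_algebra.
From mathcomp Require Import all_fingroup polyXY ring zify.
From mathcomp Require Import complex.
From mathcomp Require Import boolp classical_sets set_interval reals.
From mathcomp Require Import topology normedtype.
From mathcomp Require mpoly.

Set Implicit Arguments.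
Unset Strict Implicit.
Unset Printing Implicit Defensive.

Import Order.TTheory GRing.Theory Num.Theory.
Import numFieldNormedType.Exports.
Import (canonicals, coercions) mpoly.

Local Open Scope classical_set_scope.
Local Open Scope ring_scope.

(** * Equivalence of rows and Suslin's lemma *)

Section RowEquivalence.
Variable S : comUnitRingType.

Definition row_equiv m n (f g : 'M[S]_(m, n)) : Prop :=
  exists2 P, P \in unitmx & g = f *m P.

Lemma row_equiv_refl m n (f : 'M[S]_(m, n)) : row_equiv f f.
Proof. by exists 1%:M; rewrite ?unitmx1 ?mulmx1. Qed.

Lemma row_equiv_sym m n (f g : 'M[S]_(m, n)) : row_equiv f g -> row_equiv g f.
Proof.
move=> [P uP ->]; exists (invmx P); rewrite ?unitmx_inv //.
by rewrite mulmxK.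
Qed.

Lemma row_equiv_trans m n (g f h : 'M[S]_(m, n)) :
  row_equiv f g -> row_equiv g h -> row_equiv f h.
Proof.
move=> [P uP ->] [Q uQ ->]; exists (P *m Q); rewrite ?unitmx_mul ?uP //.
by rewrite mulmxA.
Qed.

(** Since [a *m v = 0], the matrix [v *m a] has square zero, so that [1 - v *m a] is the inverse of
    [1 + v *m a]. This adds the combination [f *m v] of the entries to the entries selected by
    [a]. *)
Lemma row_equiv_transvection n (f : 'rV[S]_n) (v : 'cV[S]_n) (a : 'rV[S]_n) :
  a *m v = 0 -> row_equiv f (f + f *m v *m a).
Proof.
move=> av0; exists (1%:M + v *m a); last by rewrite mulmxDr mulmx1 mulmxA.
apply: (proj1 (@mulmx1_unit _ _ _ (1%:M - v *m a) _)).
rewrite mulmxDl mul1mx mulmxBr mulmx1 mulmxA -(mulmxA v) av0 mulmx0 mul0mx.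
by rewrite subr0 subrK.
Qed.

Lemma row_equiv_perm n (f : 'rV[S]_n) (i j : 'I_n) :
  row_equiv f (xcol i j f).
Proof.
exists (tperm_mx i j); rewrite ?unitmx_perm //.
by rewrite xcolE.
Qed.

End RowEquivalence.

Lemma row_equiv_map (S T : comUnitRingType) (h : {rmorphism S -> T}) m n
    (f g : 'M[S]_(m, n)) :
  row_equiv f g -> row_equiv (map_mx h f) (map_mx h g).
Proof.
move=> [P uP ->]; exists (map_mx h P); last by rewrite map_mxM.
by rewrite unitmxE det_map_mx rmorph_unit // -unitmxE.
Qed.

Lemma comp_poly_subE (R : comNzRingType) (p c d : {poly R}) :
  exists F, p \Po (c + d) = (p \Po c) + d * F.
Proof.
elim/poly_ind: p => [|p a [F IH]]; first by exists 0; rewrite !comp_poly0 mulr0 addr0.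
exists (F * (c + d) + (p \Po c)).
rewrite !comp_polyD !comp_polyM !comp_polyX !comp_polyC IH.
ring.
Qed.

(* Up to the factor b, E is the product of [[u, -y], [w, x]] and
   [[x', y'], [-w', u']], where x' = x + e b F and so on; the first factor sends
   (x, y) to (b, 0) and the second one (b, 0) to b (x', y'). All entries of this
   product are divisible by b. *)
Lemma suslin_identity (S : idomainType) (b e x y u w F G U W : S) :
    u * x + w * y = b ->
    (u + e * b * U) * (x + e * b * F) + (w + e * b * W) * (y + e * b * G) = b ->
  exists E : 'M[S]_2, E \in unitmx /\
    (row_mx x%:M y%:M : 'rV_2) *m E
      = row_mx (x + e * b * F)%:M (y + e * b * G)%:M.
Proof.
move=> def_b def_b'.
have [eb0|eb0] := eqVneq (e * b) 0.
  exists 1%:M; rewrite unitmx1; split=> //.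
  by rewrite eb0 !mul0r !addr0 mulmx1.
(* [e * b * s] is the difference of the two hypotheses; the division by [e * b] is why the case
   [e * b = 0] was treated first. *)
pose s := u * F + U * x + w * G + W * y + e * b * (U * F + W * G).
have s0 : s = 0.
  apply: (mulfI eb0); rewrite mulr0.
  have -> : e * b * s = ((u + e * b * U) * (x + e * b * F)
       + (w + e * b * W) * (y + e * b * G)) - (u * x + w * y) by rewrite /s; ring.
  by rewrite def_b def_b' subrr.
pose E : 'M[S]_(1 + 1) :=
  block_mx (1 + e * (F * u + W * y))%:M (e * (G * u - U * y))%:M
           (e * (F * w - W * x))%:M (1 + e * (G * w + U * x))%:M.
exists E; split.
  rewrite unitmxE (_ : \det E = 1) ?unitr1 //.
  rewrite (expand_det_row _ 0) !big_ord_recl big_ord0 addr0 /cofactor !det_mx11.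
  do 3!(rewrite ?mxE /=; repeat (case: splitP => [[[|?] ?] //|[[|?] ?] //] _)).
  rewrite /bump /= !mulr1n expr0 expr1.
  (* The determinant is [1 + e * s]. *)
  rewrite -[RHS]addr0 -[X in _ = _ + X](mulr0 e) -s0 /s -def_b; ring.
rewrite /E; etransitivity; first exact: (@mul_row_block _ 1 1 1 1 1).
rewrite -!scalar_mxM -!raddfD /=.
congr (row_mx _%:M _%:M); rewrite -def_b; ring.
Qed.

Section Suslin.
Variable B : idomainType.

(** The first two entries are moved from [c] to [c'] by [suslin_identity]. Every other entry changes
    by a multiple of [e * b], and [b] is a combination of the first two entries at [c'], so a column
    operation with coefficients [K] makes up for the change. *)
Lemma suslin_step n (f : 'rV[{poly B}]_(2 + n)) (b : B) (u w c e : {poly B}) :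
    u * f 0 (lshift n 0) + w * f 0 (lshift n 1) = b%:P ->
  row_equiv (map_mx (comp_poly c) f) (map_mx (comp_poly (c + e * b%:P)) f).
Proof.
move=> def_b; set c' := c + _.
have [F HF] := comp_poly_subE (f 0 (lshift n 0)) c (e * b%:P).
have [G HG] := comp_poly_subE (f 0 (lshift n 1)) c (e * b%:P).
have [U HU] := comp_poly_subE u c (e * b%:P).
have [W HW] := comp_poly_subE w c (e * b%:P).
pose x := f 0 (lshift n 0) \Po c; pose y := f 0 (lshift n 1) \Po c.
have ev_b d : (u \Po d) * (f 0 (lshift n 0) \Po d) + (w \Po d) * (f 0 (lshift n 1) \Po d) = b%:P.
  by rewrite -!comp_polyM -comp_polyD def_b comp_polyC.
have def_b' := ev_b c'; rewrite HF HG HU HW in def_b'.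
have [E [uE HE]] := suslin_identity (ev_b c) def_b'.
have [Q HQ] : exists Q : 'rV[{poly B}]_n,
    map_mx (comp_poly c') (rsubmx f) = map_mx (comp_poly c) (rsubmx f) + (e * b%:P) *: Q.
  have /fin_all_exists[q Hq] i := comp_poly_subE (f 0 (rshift 2 i)) c (e * b%:P).
  by exists (\row_i q i); apply/rowP=> i; rewrite !mxE Hq.
have splitf d : map_mx (comp_poly d) f =
    row_mx (row_mx (f 0 (lshift n 0) \Po d)%:M (f 0 (lshift n 1) \Po d)%:M : 'rV_2)
           (map_mx (comp_poly d) (rsubmx f)).
  rewrite -[f in LHS]hsubmxK map_row_mx; congr row_mx; apply/rowP=> i.
  rewrite !mxE; case: splitP => j; rewrite ord1 => /= ij; rewrite mxE eqxx mulr1n.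
    by congr (f 0 (lshift _ _) \Po _); apply: val_inj; rewrite /= ij.
  by congr (f 0 (lshift _ _) \Po _); apply: val_inj; rewrite /= ij.
pose K : 'M[{poly B}]_(2, n) := (col_mx ((u \Po c')%:M : 'M_1) ((w \Po c')%:M : 'M_1)) *m (e *: Q).
exists (block_mx E (E *m K) 0 1%:M).
  by rewrite unitmxE det_ublock det1 mulr1 -unitmxE.
rewrite !splitf mul_row_block mulmx0 addr0 mulmx1 mulmxA HE -/c' HF HG; congr row_mx.
rewrite HQ addrC; congr (_ + _).
rewrite /K mulmxA [X in _ = X *m _](@mul_row_col _ 1 1 1 1) -!scalar_mxM -raddfD /=.
rewrite -HF -HG -/c' (mulrC (f 0 (lshift n 0) \Po c')).
by rewrite (mulrC (f 0 (lshift n 1) \Po c')) ev_b mul_scalar_mx scalerA (mulrC e).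
Qed.

End Suslin.

Lemma row_equiv_unit (S : comUnitRingType) n (f : 'rV[S]_(1 + n)) :
  f 0 0 \is a GRing.unit -> row_equiv f (delta_mx 0 0).
Proof.
pose a := f 0 0; pose g := rsubmx f; move=> uf0.
have def_f : f = row_mx a%:M g.
  rewrite -{1}[f]hsubmxK; congr row_mx; apply/rowP=> i; rewrite ord1 !mxE mulr1n.
  by congr (f _ _); apply: val_inj.
have -> : delta_mx 0 0 = row_mx 1%:M 0 :> 'rV[S]_(1 + n).
  apply/rowP=> i; rewrite !mxE; case: splitP => j; rewrite !mxE => ij.
    by rewrite eqxx -val_eqE /= ij ord1.
  by rewrite eqxx -val_eqE /= ij.
exists (block_mx a^-1%:M (- (a^-1 *: g)) 0 1%:M).
  by rewrite unitmxE det_ublock det1 mulr1 det_scalar1 unitrV.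
rewrite [X in X *m _]def_f mul_row_block !mulmx0 addr0 -scalar_mxM divrr // mulmx1.
by rewrite mul_scalar_mx scalerN scalerA divrr // scale1r addNr.
Qed.

(** As the leading coefficients survive under [h], the degrees do not drop and the Sylvester matrix
    keeps its format; [h] is then applied to it entrywise. *)
Lemma rmorph_resultant (A C : comNzRingType) (h : {rmorphism A -> C}) (p q : {poly A}) :
    h (lead_coef p) != 0 -> h (lead_coef q) != 0 ->
  h (resultant p q) = resultant (map_poly h p) (map_poly h q).
Proof.
move=> nz_hp nz_hq; rewrite /resultant /Sylvester_mx !size_map_poly_id0 //.
rewrite -det_map_mx /= map_col_mx; congr (\det (col_mx _ _));
  by apply: map_lin1_mx => v; rewrite map_poly_rV rmorphM /= map_rVpoly.
Qed.

(** * The theorem of Quillen and Suslin *)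

Section Points.
Variables (F : numClosedFieldType).

Definition point (B : idomainType) (emb : F -> B) (ev : B -> F) : Prop :=
  forall c, ev (emb c) = c.

(** Over F[q_1, ..., q_m] the Nullstellensatz identifies rows without a zero at any point with
    unimodular rows. The formulation by points fits the freeness condition, which is known at each
    [q]. *)
Definition unimodular_rows_trivial (B : idomainType) (emb : F -> B) : Prop :=
  forall n (f : 'rV[B]_(1 + n)),
    (forall ev : {rmorphism B -> F}, point emb ev -> map_mx ev f != 0) ->
  row_equiv f (delta_mx 0 0).

(** Noether's change of variables in abstract form: the substitution [s] makes [f] monic up to a
    unit, and its left inverse [t] carries equivalences of rows back. *)
Definition monicizable (B : idomainType) (emb : F -> B) : Prop :=
  forall f : {poly B}, f != 0 ->
  exists s t : {rmorphism {poly B} -> {poly B}},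
    [/\ cancel s t, forall c, s (emb c)%:P = (emb c)%:P
      & lead_coef (s f) \is a GRing.unit].

(** * Rows over B[t] with an entry whose leading coefficient is a unit *)

Section Horrocks.
Variables (B : idomainType) (emb : F -> B).
Hypothesis urtB : unimodular_rows_trivial emb.

Definition pev (ev : {rmorphism B -> F}) (r : F) : {rmorphism {poly B} -> F} :=
  (horner_eval r \o map_poly ev)%FUN.

Lemma pev_point (ev : {rmorphism B -> F}) r :
  point emb ev -> point (fun c => (emb c)%:P) (pev ev r).
Proof. by move=> pt c; rewrite /= map_polyC /= /horner_eval hornerC pt. Qed.

(** Over a ring without points even the zero row of length one would satisfy the condition on rows,
    but it is not equivalent to [delta_mx 0 0]. *)
Lemma point_exists : exists ev : {rmorphism B -> F}, point emb ev.
Proof.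
case: (pselect (exists ev : {rmorphism B -> F}, point emb ev)) => // noev.
have [|P _ /rowP/(_ 0)] := @urtB 0 0; first by move=> ev pt; case: noev; exists ev.
by rewrite mul0mx !mxE eqxx => /eqP; rewrite oner_eq0.
Qed.

(* For each of the finitely many roots r only finitely many k are bad, whence the
   uniform bound on k. *)
Lemma common_roots_avoid (f0 : {poly F}) n (h : F -> 'I_n.+1 -> F) :
    f0 != 0 -> (forall r, root f0 r -> exists i, h r i != 0) ->
  exists2 k : nat, (k <= size f0 * n)%N &
    forall r, root f0 r -> \sum_i h r i * k%:R ^+ i != 0.
Proof.
move=> nz_f0 nz_h; have [rs def_f0] := closed_field_poly_normal f0.
pose hp r := \poly_(i < n.+1) h r (inord i).
have hp_eval r x : (hp r).[x] = \sum_i h r i * x ^+ i.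
  by rewrite horner_poly; apply: eq_bigr => i _; rewrite inord_val.
have root_rs r : root f0 r = (r \in rs).
  by rewrite def_f0 rootZ ?lead_coef_eq0 // root_prod_XsubC.
have nz_hp r : r \in rs -> hp r != 0.
  rewrite -root_rs => /nz_h[l]; apply: contra => /eqP hp0.
  have := coef_poly n.+1 (fun i => h r (inord i)) l.
  by rewrite -/(hp r) hp0 coef0 ltn_ord inord_val => <-.
(* The bad k are the roots of [H], whose degree is at most [size rs * n]; hence one of the naturals
   0, ..., [size rs * n] is good. *)
pose H := \prod_(r <- rs) hp r.
have nz_H : H != 0 by rewrite prodf_seq_neq0; apply/allP=> r /nz_hp.
have size_H : (size H <= (size rs * n).+1)%N.
  rewrite /H; elim: (rs) => [|r s IHs]; first by rewrite big_nil size_poly1.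
  rewrite big_cons; apply: leq_trans (size_polyMleq _ _) _.
  rewrite -subn1 leq_subLR mulSn add1n -addSn -addnS.
  by apply: leq_add IHs; apply: size_poly.
have size_rs : (size rs * n <= size f0 * n)%N.
  have -> : size f0 = (size rs).+1.
    by rewrite def_f0 size_scale ?lead_coef_eq0 // size_prod_XsubC.
  by rewrite leq_mul2r leqnSn orbT.
have [|/hasPn all_root] := boolP (has (fun k : nat => H.[k%:R] != 0) (iota 0 (size rs * n).+1)).
  move=> /hasP[k]; rewrite mem_iota ltnS /= => /leq_trans/(_ size_rs) lekK nz_Hk.
  exists k; first exact: lekK.
  move=> r; rewrite root_rs => r_rs; rewrite -hp_eval.
  apply: contraNneq nz_Hk => hpk; rewrite /H horner_prod prodf_seq_eq0.
  by apply/hasP; exists r; rewrite ?hpk ?eqxx.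
pose zs := [seq k%:R : F | k <- iota 0 (size rs * n).+1].
have : (size zs < size H)%N.
  apply: max_poly_roots => //.
    by apply/allP=> _ /mapP[k k_in ->]; have := all_root k k_in; rewrite negbK.
  by rewrite map_inj_uniq ?iota_uniq // => k l /eqP; rewrite eqr_nat => /eqP.
by rewrite size_map size_iota ltnNge size_H.
Qed.

Lemma horrocks n (f : 'rV[{poly B}]_(1 + n)) :
    (forall ev : {rmorphism {poly B} -> F},
      point (fun c => (emb c)%:P) ev -> map_mx ev f != 0) ->
    lead_coef (f 0 0) \is a GRing.unit ->
  row_equiv f (delta_mx 0 0).
Proof.
case: n f => [|n] f nz_f unit_lc.
  (* In a row of length one, a root of the specialized entry would be a common zero; so the entry is
     constant, equal to its unit leading coefficient. *)
  apply: row_equiv_unit.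
  have [ev pt] := point_exists.
  have size_p : size (map_poly ev (f 0 0)) = size (f 0 0).
    by rewrite size_map_poly_id0 // -unitfE rmorph_unit.
  suff /eqP/size_poly1P[c nz_c def_f] : size (f 0 0) = 1.
    move: unit_lc.
    by rewrite def_f lead_coefC poly_unitE size_polyC nz_c coefC.
  apply/eqP; rewrite -size_p; apply: contraT => /closed_rootP[r /rootP root_r].
  case/negP: (nz_f _ (pev_point r pt)); apply/eqP/rowP=> i.
  by rewrite ord1 !mxE.
have [/size_poly1P[c nz_c def_f]|size_f0] := boolP (size (f 0 0) == 1).
  apply: row_equiv_unit; move: unit_lc.
  by rewrite def_f lead_coefC poly_unitE size_polyC nz_c coefC.
have {}size_f0 : (1 < size (f 0 0)%R)%N.
  rewrite ltn_neqAle eq_sym size_f0 size_poly_gt0.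
  by apply: contraTneq unit_lc => ->; rewrite lead_coef0 unitr0.
pose i1 : 'I_(1 + n.+1) := rshift 1 (ord0 : 'I_n.+1).
(* With the weights k^i, the value of [g k] at a given root of a specialization of f_0 is a
   polynomial in k; it is not identically zero, as the root is no common zero of the row. *)
pose g (k : nat) := \sum_(i < n.+1) (k%:R ^+ i)%:P * f 0 (rshift 1 i).
(* The term in f_0 makes G k have the same leading coefficient as f_0, so that
   resultants commute with evaluation at the points of B. *)
pose e k := (size (g k)).+1.
pose G k := 'X^(e k) * f 0 0 + g k.
have size_Xf k : size ('X^(e k) * f 0 0) = (size (f 0 0)%R + e k)%N.
  by rewrite mulrC size_mulXn ?(addnC (e k)) // -size_poly_gt0 ltnW.
have lt_size k : (size (g k) < size ('X^(e k) * f 0 0)%R)%N.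
  by rewrite size_Xf /e addnS ltnS leq_addl.
have lc_G k : lead_coef (G k) = lead_coef (f 0 0).
  by rewrite lead_coefDl // mulrC lead_coef_Mmonic ?monicXn.
have size_G k : (1 < size (G k))%N.
  by rewrite size_polyDl // size_Xf ltn_addr.
pose b k := resultant (f 0 0) (G k).
have step k (c d : {poly B}) :
    row_equiv (map_mx (comp_poly c) f) (map_mx (comp_poly (c + d * (b k)%:P)) f).
  (* The transvection along [v] and [a] turns the second entry into [G k]. The coefficient of this
     entry in [v] is 0, because the entry already occurs in [G k] with coefficient k^0 = 1. *)
  pose v : 'cV[{poly B}]_(1 + n.+1) :=
    col_mx ('X^(e k))%:M (\col_i if i == 0 then 0 else (k%:R ^+ i)%:P).
  pose a : 'rV[{poly B}]_(1 + n.+1) := delta_mx 0 i1.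
  have av0 : a *m v = 0 by rewrite -rowE /v; apply/rowP=> j; rewrite mxE col_mxEd !mxE.
  pose f' := f + f *m v *m a.
  have ff' : row_equiv f f' by apply: row_equiv_transvection.
  have f'0 : f' 0 (lshift n (0 : 'I_2) : 'I_(2 + n)) = f 0 0.
    rewrite /f' mxE [X in _ + X]mxE big_ord1 !mxE. rewrite (_ : _ == i1 = false) //.
    by rewrite andbF mulr0 addr0; congr (f _ _); apply: val_inj.
  have f'1 : f' 0 (lshift n (1 : 'I_2) : 'I_(2 + n)) = G k.
    rewrite /f' mxE [X in _ + X]mxE big_ord1 !mxE (_ : (_ == i1) = true) //.
    rewrite eqxx mulr1 big_split_ord big_ord1 big_ord_recl /= col_mxEu.
    rewrite (eq_bigr (fun i : 'I_n =>
      (k%:R ^+ (lift 0 i))%:P * f 0 (rshift 1 (lift 0 i)))); last first.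
      by move=> i _; rewrite col_mxEd mxE mulrC.
    rewrite col_mxEd !mxE mulr0 add0r mulr1n /G /g big_ord_recl expr0 mul1r.
    rewrite [LHS]addrCA mulrC; congr (_ * f _ _ + (f _ _ + _)); exact: val_inj.
  have [[u w] _ /= Huw] := resultant_in_ideal size_f0 (size_G k).
  have Huw' : u * f' 0 (lshift n (0 : 'I_2) : 'I_(2 + n))
      + w * f' 0 (lshift n (1 : 'I_2) : 'I_(2 + n)) = (b k)%:P.
    by rewrite f'0 f'1.
  apply: row_equiv_trans (row_equiv_map _ ff') _.
  apply: row_equiv_trans (suslin_step c d Huw') _.
  by apply: row_equiv_map; apply: row_equiv_sym.
(* At every point some k up to [K] is good; the bound does not depend on the point, since
   specialization preserves the size of f_0. So finitely many resultants have no common zero. *)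
pose K := (size (f 0 0)%R * n)%N.
have [P uP bP] : row_equiv (\row_(k < 1 + K) b k) (delta_mx 0 0).
  apply: urtB => ev pt.
  have ev_lc : ev (lead_coef (f 0 0)) != 0 by rewrite -unitfE rmorph_unit.
  have size_p : size (map_poly ev (f 0 0)) = size (f 0 0).
    by rewrite size_map_poly_id0.
  have [||k lekK nz_k] := @common_roots_avoid (map_poly ev (f 0 0)) n
    (fun r i => pev ev r (f 0 (rshift 1 i))).
  - by rewrite -size_poly_gt0 size_p ltnW.
  - move=> r root_r; apply: contrapT => no_i.
    case/negP: (nz_f _ (pev_point r pt)); apply/eqP/rowP=> i.
    rewrite !mxE; case: (split_ordP i) => j ->.
      rewrite ord1 (_ : f 0 _ = f 0 0); first exact/rootP.
      by congr (f _ _); apply: val_inj.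
    by apply/eqP; apply: contra_notT no_i => nz; exists j.
  apply/eqP => /rowP/(_ (inord k)); rewrite !mxE inordK; last by rewrite ltnS /K -size_p.
  rewrite /b rmorph_resultant ?lc_G // => /eqP.
  rewrite resultant_eq0 => gt1.
  have /closed_rootP[r] : size (gcdp (map_poly ev (f 0 0)) (map_poly ev (G k))) != 1%N.
    by apply: contraTneq gt1 => ->.
  rewrite root_gcd => /andP[r_f /rootP].
  rewrite rmorphD rmorphM hornerD hornerM (rootP r_f) mulr0 add0r => /eqP.
  apply/negP; have := nz_k r r_f; congr (_ != 0).
  rewrite /g rmorph_sum horner_sum; apply: eq_bigr => i _.
  by rewrite rmorphM hornerM /= map_polyC hornerC /= rmorphXn rmorph_nat mulrC.
(* The column [P k 0] gives the coefficients a_k of 1 = sum_k a_k b_k. Moving the argument by t a_k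
   b_k for each k in turn leads from 0 to t. *)
have telescope (s : seq 'I_(1 + K)) :
    row_equiv (map_mx (comp_poly 0) f)
      (map_mx (comp_poly (\sum_(k <- s) ('X * (P k 0)%:P) * (b k)%:P)) f).
  elim: s => [|k s IHs]; first by rewrite big_nil; apply: row_equiv_refl.
  by apply: row_equiv_trans IHs _; rewrite big_cons addrC; apply: step.
have f_f0 : row_equiv (map_mx (comp_poly 0) f) f.
  have := telescope (index_enum _).
  rewrite (_ : \sum_(k <- _) _ = 'X).
    by congr row_equiv; apply/matrixP=> i j; rewrite mxE comp_polyXr.
  have /rowP/(_ 0) := bP; rewrite !mxE !eqxx /= => sum1.
  under eq_bigr do rewrite -mulrA -polyCM.
  rewrite -mulr_sumr -raddf_sum /= (_ : \sum_(k <- _) _ = 1) ?mulr1 //.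
  by etransitivity; last exact: (esym sum1); apply: eq_bigr => k _; rewrite mxE mulrC.
apply: row_equiv_trans (row_equiv_sym f_f0) _.
have -> : map_mx (comp_poly 0) f = map_mx polyC (map_mx (coefp 0) f).
  by apply/matrixP=> i j; rewrite !mxE comp_poly0r.
have -> : delta_mx 0 0 = map_mx polyC (delta_mx 0 0) :> 'rV[{poly B}]_(1 + n.+1).
  by rewrite map_delta_mx.
apply: row_equiv_map; apply: urtB => ev pt.
apply: contra (nz_f _ (pev_point 0 pt)) => /eqP f0; apply/eqP/rowP=> i.
have /rowP/(_ i) := f0; rewrite !mxE /= => f0i.
by rewrite /horner_eval horner_coef0 coef_map.
Qed.

End Horrocks.
End Points.

Lemma row_equiv_unit_at (S : comUnitRingType) n (f : 'rV[S]_(1 + n)) i :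
  f 0 i \is a GRing.unit -> row_equiv f (delta_mx 0 0).
Proof.
move=> ufi; apply: row_equiv_trans (row_equiv_perm f 0 i) _.
by apply: row_equiv_unit; rewrite mxE tpermL.
Qed.

(** * Adjoining a variable, and the completion of matrices *)

Section QuillenSuslin.
Variables (F : numClosedFieldType).

(** Some entry is nonzero, there being a point. Brought to the front and made monic by [s], it
    allows [horrocks] to be applied; [t] carries the result back. *)
Lemma unimodular_rows_trivial_poly (B : idomainType) (emb : F -> B) :
    unimodular_rows_trivial emb -> monicizable emb ->
  unimodular_rows_trivial (fun c => (emb c)%:P).
Proof.
move=> urtB monB n f nz_f.
have [i nz_fi] : exists i, f 0 i != 0.
  apply: contrapT => no_i; have [ev pt] := point_exists urtB.
  case/negP: (nz_f _ (pev_point 0 pt)); apply/eqP/rowP=> i; rewrite !mxE.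
  have [-> | nz] := eqVneq (f 0 i) 0; first by rewrite rmorph0.
  by case: no_i; exists i.
have [s [t [st s_emb unit_lc]]] := monB _ nz_fi.
pose f' := map_mx s (xcol 0 i f).
have nz_f' (ev : {rmorphism {poly B} -> F}) :
    point (fun c => (emb c)%:P) ev -> map_mx ev f' != 0.
  move=> pt; apply: contra (nz_f (ev \o s)%FUN _) => [/eqP f'0|c /=].
    apply/eqP/rowP=> j; have /rowP/(_ (tperm 0 i j)) := f'0.
    by rewrite !mxE tpermK.
  by rewrite s_emb pt.
have f'_e0 : row_equiv f' (delta_mx 0 0).
  by apply: (horrocks urtB nz_f'); rewrite !mxE tpermL.
apply: row_equiv_trans (row_equiv_perm f 0 i) _.
have <- : map_mx t f' = xcol 0 i f by apply/matrixP=> k j; rewrite !mxE st.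
by rewrite -(map_delta_mx t); apply: row_equiv_map.
Qed.

(* If the leading coefficient in y is monic in t, substituting y + t^K for y with
   K large makes the polynomial monic in t; then t and y are exchanged. *)
Lemma monicizable_poly (B : idomainType) (emb : F -> B) :
  monicizable emb -> monicizable (fun c => (emb c)%:P).
Proof.
move=> monB f nz_f.
have [s [t [st s_emb unit_lc]]] := monB (lead_coef f) ltac:(by rewrite lead_coef_eq0).
(* [K] exceeds the sizes of all coefficients, so that in the sizes [K * i + size (s f_i)] of the
   terms the top exponent i dominates. *)
pose D := \max_(i < size f) size (s (f`_i)%R); pose K := D.+1.
pose s' : {rmorphism {poly {poly B}} -> {poly {poly B}}} :=
  (swapXY \o comp_poly ('X + ('X^K)%:P) \o map_poly s)%FUN.
pose t' : {rmorphism {poly {poly B}} -> {poly {poly B}}} :=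
  (map_poly t \o comp_poly ('X - ('X^K)%:P) \o swapXY)%FUN.
exists s', t'; split.
- move=> p; rewrite /= swapXYK -comp_polyA comp_polyD comp_polyX comp_polyC.
  rewrite subrK comp_polyXr -map_poly_comp_id0 ?rmorph0 //.
  by rewrite map_poly_id // => q _ /=; apply: st.
- by move=> c; rewrite /= map_polyC /= s_emb comp_polyC swapXY_polyC map_polyC.
pose term i := map_poly polyC (s (f`_i)) * ('X%:P + 'X^K) ^+ i.
have def_s'f : s' f = \sum_(i < size f) term i.
  rewrite -{1}[f]coefK poly_def rmorph_sum; apply: eq_bigr => i _.
  rewrite -mul_polyC rmorphM rmorphXn /= map_polyC map_polyX /=.
  by rewrite comp_polyC comp_polyX swapXY_polyC rmorphD /= swapXY_X swapXY_polyC map_polyXn.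
have size_lin : size ('X%:P + 'X^K : {poly {poly B}}) = K.+1.
  by rewrite addrC size_XnaddC.
have lc_lin : lead_coef ('X%:P + 'X^K : {poly {poly B}}) = 1.
  by rewrite addrC lead_coefXnaddC.
have nz_lin : 'X%:P + 'X^K != 0 :> {poly {poly B}}.
  by rewrite -lead_coef_eq0 lc_lin oner_eq0.
have size_map (p : {poly B}) : size (map_poly polyC p) = size p.
  by rewrite size_map_inj_poly //; apply: polyC_inj.
have size_term i : s (f`_i) != 0 -> size (term i) = (size (s (f`_i)%R) + K * i)%N.
  move=> nz; have nz_pow : ('X%:P + 'X^K) ^+ i != 0 :> {poly {poly B}} by rewrite expf_neq0.
  rewrite size_mul // -?size_poly_eq0 ?size_map ?size_poly_eq0 //.
  have := size_exp ('X%:P + 'X^K : {poly {poly B}}) i; rewrite size_lin /= => <-.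
  by rewrite -!subn1 addnBA ?size_poly_gt0.
have size_f : size f = (size f).-1.+1 by rewrite prednK // size_poly_gt0.
have nz_slc : s (f`_(size f).-1) != 0.
  by apply: contraTneq unit_lc => lc0; rewrite /lead_coef lc0 coef0 unitr0.
rewrite def_s'f size_f big_ord_recr /= addrC lead_coefDl.
  rewrite lead_coefM lead_coef_exp lc_lin expr1n mulr1.
  by rewrite lead_coef_map_inj ?rmorph_unit //; apply: polyC_inj.
rewrite size_term // -/(lead_coef f).
apply: leq_ltn_trans (size_sum _ _ _) _.
apply: (@leq_ltn_trans (K * (size f).-1)); last first.
  by rewrite -[X in (X < _)%N]add0n ltn_add2r size_poly_gt0.
apply/bigmax_leqP => i _; have [sfi0|/size_term ->] := eqVneq (s (f`_i)) 0.
  by rewrite /term sfi0 rmorph0 mul0r size_poly0.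
have lt_i : (i < size f)%N by rewrite (leq_trans (ltn_ord i)) ?leq_pred.
have le_D : (size (s (f`_i)%R) <= D)%N by apply: (leq_bigmax (Ordinal lt_i)).
rewrite (leq_trans (leq_add le_D (leqnn _))) // (leq_trans (leq_add (leqnSn D) (leqnn _))) //.
by rewrite -mulnS leq_mul2l ltn_ord orbT.
Qed.

(** [K] completes [M] to an invertible square matrix, and [P] and [Q] are the blocks of the inverse.
    Column operations reduce the first row to (1, 0, ..., 0); the induction is applied to the block
    [M'] that remains below and to the right. *)
Lemma unimodular_matrix (B : idomainType) (emb : F -> B) r N (M : 'M[B]_(r, N)) :
    unimodular_rows_trivial emb ->
    (forall ev : {rmorphism B -> F}, point emb ev -> row_free (map_mx ev M)) ->
  exists k (K : 'M[B]_(k, N)) (P : 'M_(N, r)) (Q : 'M_(N, k)),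
    [/\ (r + k = N)%N, P *m M + Q *m K = 1%:M, M *m P = 1%:M, K *m Q = 1%:M
      & M *m Q = 0 /\ K *m P = 0].
Proof.
move=> urtB; elim: r N M => [|r IHr] N M freeM.
  exists N, 1%:M, 0, 1%:M; split; rewrite ?mul0mx ?mulmx1 ?add0r //.
    by apply/matrixP=> -[].
  by split; [apply/matrixP=> -[] | rewrite mulmx0].
case: N M freeM => [|n] M freeM.
  have [ev pt] := point_exists urtB.
  have := freeM ev pt; rewrite /row_free => /eqP rM.
  by have := rank_leq_col (map_mx ev M); rewrite rM.
move: M freeM; rewrite -[r.+1]/(1 + r)%N -[n.+1]/(1 + n)%N => M freeM.
have [|A uA def_e0] := urtB n (row 0 M).
  move=> ev pt; rewrite map_row; apply/negP=> /eqP row0.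
  have := freeM ev pt; move/row_freeP=> [Z /(congr1 (row 0))].
  rewrite row_mul row0 mul0mx => /rowP/(_ 0); rewrite !mxE eqxx => /eqP.
  by rewrite eq_sym oner_eq0.
have [MA MAE] : {MA : 'M_(1 + r, 1 + n) | MA = M *m A} by exists (M *m A).
pose a := dlsubmx MA; pose M' := drsubmx MA.
have MA0 j : MA (lshift r 0) j = (j == 0)%:R.
  have /rowP/(_ j) := def_e0; rewrite -row_mul -MAE !mxE eqxx /= => ->.
  by congr (MA _ _); apply: val_inj.
have def_MA : MA = block_mx 1%:M 0 a M'.
  rewrite -[LHS]submxK /a /M'.
  have -> : ulsubmx MA = 1%:M by apply/matrixP=> i j; rewrite !ord1 !mxE MA0.
  have -> // : ursubmx MA = 0 by apply/matrixP=> i j; rewrite ord1 !mxE MA0.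
have def_M : M = block_mx 1%:M 0 a M' *m invmx A by rewrite -def_MA MAE mulmxK.
have [|k [K [P [Q [rk PMQK MP KQ [MQ KP]]]]]] := IHr n M'.
  move=> ev pt; have freeMev := freeM ev pt.
  apply: inj_row_free => v vM'.
  (* A relation [v] between the rows of [M'] extends to a relation [w] between the rows of [M]. *)
  pose w : 'rV_(1 + r) := row_mx (- (v *m map_mx ev a)) v.
  have wM : w *m map_mx ev M = 0.
    rewrite {1}def_M map_mxM map_block_mx map_mx1 map_mx0 mulmxA.
    rewrite [w *m _]mul_row_block mulmx1 mulmx0 add0r addNr vM' row_mx0.
    by rewrite mul0mx.
  have /(congr1 rsubmx) : w = 0 by apply: (row_free_inj freeMev); rewrite wM mul0mx.
  by rewrite row_mxKr raddf0.
exists k, (row_mx 0 K *m invmx A), (A *m block_mx 1%:M 0 (- P *m a) P).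
exists (A *m col_mx 0 Q).
have mulAK p q (X : 'M_(p, 1 + n)) (Y : 'M_(1 + n, q)) :
    X *m invmx A *m (A *m Y) = X *m Y.
  by rewrite mulmxA mulmxKV.
split; rewrite ?[in LHS]def_M ?mulAK.
- by rewrite -rk.
- rewrite -!mulmxA -mulmxDr !(mulmxA _ _ (invmx A)) -mulmxDl.
  rewrite [_ *m block_mx _ _ _ _]mulmx_block mul_col_row ?(mulmx0, mul0mx, mulmx1, mul1mx).
  rewrite add_block_mx ?(addr0, add0r) mulNmx addNr PMQK -scalar_mx_block mul1mx.
  by rewrite mulmxV.
- rewrite [_ *m block_mx _ _ _ _]mulmx_block ?(mulmx0, mul0mx, mulmx1, mul1mx) ?(addr0, add0r).
  by rewrite mulNmx mulmxN mulmxA MP mul1mx subrr -scalar_mx_block.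
- by rewrite mul_row_col mul0mx add0r.
split; rewrite ?[in LHS]def_M ?mulAK.
  by rewrite [_ *m _]mul_block_col ?mulmx0 ?mul0mx ?addr0 MQ add0r col_mx0.
by rewrite mul_row_block ?mul0mx ?add0r mulNmx mulmxN mulmxA KP mul0mx oppr0 row_mx0.
Qed.

(** F[q_1, ..., q_m] as an iterated ring of univariate polynomials, whose variables are interpreted
    by the functions [x i] on [T]. The last clause says that its elements become polynomial
    functions of the [x i], in a form that applies to any class of functions closed under sums and
    products. *)
Lemma polynomial_rings (T : Type) m (x : 'I_m -> T -> F) :
  exists (B : idomainType) (emb : {rmorphism F -> B}) (X : 'I_m -> B)
      (ev : T -> {rmorphism B -> F}),
    [/\ unimodular_rows_trivial emb /\ monicizable emb,
        forall v, point emb (ev v),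
        forall v i, ev v (X i) = x i v
      & forall Q : (T -> F) -> Prop,
        (forall c, Q (fun=> c)) -> (forall i, Q (x i)) ->
        (forall f g, Q f -> Q g -> Q (fun v => f v + g v)) ->
        (forall f g, Q f -> Q g -> Q (fun v => f v * g v)) ->
        forall p, Q (fun v => ev v p)].
Proof.
elim: m x => [|m IHm] x.
  exists F, idfun, (fun=> 0), (fun=> idfun); split=> //; last by move=> v [].
  split.
    move=> n f nz_f.
    have [i nz_fi] : exists i, f 0 i != 0.
      apply: contrapT => no_i; case/negP: (nz_f idfun (fun c => erefl)).
      apply/eqP/rowP=> i; rewrite !mxE /=; apply: contrapT => nz; case: no_i.
      by exists i; apply/eqP.
    by apply: (@row_equiv_unit_at _ _ _ i); rewrite unitfE.
  move=> f nz_f; exists idfun, idfun; split=> //.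
  by rewrite unitfE lead_coef_eq0.
have [B [emb [X [ev [[urtB monB] pt evX closedB]]]]] := IHm (fun i => x (lift ord0 i)).
exists {poly B}, (polyC \o emb)%FUN.
exists (fun i => if unlift ord0 i is Some j then (X j)%:P else 'X).
exists (fun v => pev (ev v) (x ord0 v)); split.
- split; last exact: monicizable_poly.
  exact: unimodular_rows_trivial_poly.
- by move=> v; apply: pev_point.
- move=> v i; case: unliftP => [j ->|->] /=.
    by rewrite map_polyC /horner_eval hornerC /= evX.
  by rewrite map_polyX /horner_eval hornerX.
move=> Q Qc Qx QD QM; elim/poly_ind => [|p c IHp].
  under eq_fun do rewrite rmorph0.
  exact: Qc.
under eq_fun do rewrite rmorphD rmorphM /= map_polyX map_polyC /= /horner_eval hornerX hornerC.
apply: (QD); first by apply: QM.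
by apply: closedB.
Qed.

End QuillenSuslin.

(** * Polynomial maps *)

Section PolynomialMaps.
Variable F : fieldType.
Implicit Types E : vectType F.

Definition polyfun E (f : E -> F) : Prop := exists p, forall x, f x = peval p x.

Definition polymap E E' (f : E -> E') : Prop :=
  forall i, polyfun (fun x => coords (f x) i).

Lemma polyfun_cst E (c : F) : polyfun (fun _ : E => c).
Proof. by exists (mpoly.mpolyC _ c) => x; rewrite /peval mpoly.mevalC. Qed.

Lemma polyfunD E (f g : E -> F) :
  polyfun f -> polyfun g -> polyfun (fun x => f x + g x).
Proof.
by move=> [p fp] [q gq]; exists (p + q) => x; rewrite /peval mpoly.mevalD fp gq.
Qed.

Lemma polyfunM E (f g : E -> F) :
  polyfun f -> polyfun g -> polyfun (fun x => f x * g x).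
Proof.
by move=> [p fp] [q gq]; exists (p * q) => x; rewrite /peval mpoly.mevalM fp gq.
Qed.

Lemma polyfun_coords E i : polyfun (fun x : E => coords x i).
Proof. by exists (mpoly.mpolyX F (mpoly.mnm1 i)) => x; rewrite /peval mpoly.mevalXU. Qed.

Lemma polyfun_sum E I (r : seq I) (P : pred I) (f : I -> E -> F) :
    (forall i, P i -> polyfun (f i)) ->
  polyfun (fun x => \sum_(i <- r | P i) f i x).
Proof.
move=> pf; elim: r => [|i r IHr].
  by under eq_fun do rewrite big_nil; apply: polyfun_cst.
under eq_fun do rewrite big_cons.
by case Pi: (P i) => //; apply: polyfunD => //; apply: pf.
Qed.

Lemma polyfun_prod E I (r : seq I) (P : pred I) (f : I -> E -> F) :
    (forall i, P i -> polyfun (f i)) ->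
  polyfun (fun x => \prod_(i <- r | P i) f i x).
Proof.
move=> pf; elim: r => [|i r IHr].
  by under eq_fun do rewrite big_nil; apply: polyfun_cst.
under eq_fun do rewrite big_cons.
by case Pi: (P i) => //; apply: polyfunM => //; apply: pf.
Qed.

Lemma polyfun_exp E (f : E -> F) k : polyfun f -> polyfun (fun x => f x ^+ k).
Proof.
move=> pf; elim: k => [|k IHk]; first exact: polyfun_cst.
by under eq_fun do rewrite exprS; apply: polyfunM.
Qed.

Lemma polyfun_meval E m (p : mpoly.mpoly m F) (f : 'I_m -> E -> F) :
    (forall i, polyfun (f i)) -> polyfun (fun x => mpoly.meval (f^~ x) p).
Proof.
move=> pf; under eq_fun do rewrite mpoly.mevalE.
apply: polyfun_sum => d _; apply: polyfunM; first exact: polyfun_cst.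
by apply: polyfun_prod => i _; apply: polyfun_exp.
Qed.

Lemma vect_coordsE E (x : E) : x = \sum_i coords x i *: (vbasis {:E})`_i.
Proof. exact: (coord_vbasis (memvf x)). Qed.

Lemma polyfun_comp E E' (f : E' -> F) (g : E -> E') :
  polyfun f -> polymap g -> polyfun (fun x => f (g x)).
Proof.
by move=> [p fp] pg; under eq_fun do rewrite fp; apply: polyfun_meval.
Qed.

Lemma polymap_comp E E' E'' (f : E' -> E'') (g : E -> E') :
  polymap f -> polymap g -> polymap (fun x => f (g x)).
Proof. by move=> pf pg i; apply: (polyfun_comp (pf i)). Qed.

Lemma polymap_id E : polymap (fun x : E => x).
Proof. exact: polyfun_coords. Qed.

Lemma polymap_cst E E' (c : E') : polymap (fun _ : E => c).
Proof. by move=> i; apply: polyfun_cst. Qed.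

Lemma polymapD E E' (f g : E -> E') :
  polymap f -> polymap g -> polymap (fun x => f x + g x).
Proof.
move=> pf pg i; rewrite /coords; under eq_fun do rewrite linearD.
exact: (polyfunD (pf i) (pg i)).
Qed.

Lemma polymapZ E E' (a : E -> F) (f : E -> E') :
  polyfun a -> polymap f -> polymap (fun x => a x *: f x).
Proof.
move=> pa pf i; rewrite /coords; under eq_fun do rewrite linearZ.
exact: (polyfunM pa (pf i)).
Qed.

Lemma polymapN E E' (f : E -> E') : polymap f -> polymap (fun x => - f x).
Proof.
move=> pf; under eq_fun do rewrite -scaleN1r.
by apply: polymapZ => //; apply: polyfun_cst.
Qed.

Lemma polymapB E E' (f g : E -> E') :
  polymap f -> polymap g -> polymap (fun x => f x - g x).
Proof. by move=> pf pg; apply: polymapD => //; apply: polymapN. Qed.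

Lemma polymap_sum E E' I (r : seq I) (P : pred I) (f : I -> E -> E') :
    (forall i, P i -> polymap (f i)) ->
  polymap (fun x => \sum_(i <- r | P i) f i x).
Proof.
move=> pf; elim: r => [|i r IHr].
  by under eq_fun do rewrite big_nil; apply: polymap_cst.
under eq_fun do rewrite big_cons.
by case Pi: (P i) => //; apply: polymapD => //; apply: pf.
Qed.

Lemma polyfun_linear E (f : {linear E -> F^o}) : polyfun f.
Proof.
rewrite -[X in polyfun X]/(fun x => f x).
under eq_fun do rewrite [X in f X]vect_coordsE linear_sum.
apply: polyfun_sum => i _; under eq_fun do rewrite linearZ.
by apply: polyfunM; [apply: polyfun_coords | apply: polyfun_cst].
Qed.

Lemma polymap_linear E E' (f : {linear E -> E'}) : polymap f.
Proof.
rewrite -[X in polymap X]/(fun x => f x).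
under eq_fun do rewrite [X in f X]vect_coordsE linear_sum.
apply: polymap_sum => i _; under eq_fun do rewrite linearZ.
by apply: polymapZ; [apply: polyfun_coords | apply: polymap_cst].
Qed.

Lemma linear_polyfun E (f : E -> F) : linear (f : E -> F^o) -> polyfun f.
Proof.
move=> lin; pose h : {linear E -> F^o} := HB.pack (f : E -> F^o)
  (GRing.isLinear.Build F E F^o *:%R (f : E -> F^o) lin).
exact: (polyfun_linear h).
Qed.

Lemma linear_polymap E E' (f : E -> E') : linear f -> polymap f.
Proof.
move=> lin; pose h : {linear E -> E'} := HB.pack f
  (GRing.isLinear.Build F E E' *:%R f lin).
exact: (polymap_linear h).
Qed.

Lemma polymap_lfun E E' (f : 'Hom(E, E')) : polymap f.
Proof. exact: polymap_linear. Qed.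

Lemma polymap_fst E E' : polymap (fst : E * E' -> E).
Proof. exact: polymap_linear. Qed.

Lemma polymap_snd E E' : polymap (snd : E * E' -> E').
Proof. exact: polymap_linear. Qed.

Lemma polymap_pair E E1 E2 (f : E -> E1) (g : E -> E2) :
  polymap f -> polymap g -> polymap (fun x => (f x, g x)).
Proof.
move=> pf pg.
have -> : (fun x => (f x, g x)) = (fun x => (f x, 0) + (0, g x)).
  by apply/funext => x; rewrite /GRing.add /= /add_pair /= addr0 add0r.
apply: polymapD.
  apply: (polymap_comp (f := fun u : E1 => (u, 0 : E2))) => //.
  by apply: linear_polymap => a u v; apply: injective_projections; rewrite //= scaler0 addr0.
apply: (polymap_comp (f := fun u : E2 => (0 : E1, u))) => //.
by apply: linear_polymap => a u v; apply: injective_projections; rewrite //= scaler0 addr0.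
Qed.

Lemma polyfun_entry m n i j : polyfun (fun A : 'M[F]_(m, n) => A i j).
Proof. by apply: linear_polyfun => a A B; rewrite !mxE. Qed.

Lemma polymap_entries E m n (f : E -> 'M[F]_(m, n)) :
  (forall i j, polyfun (fun x => f x i j)) -> polymap f.
Proof.
move=> pf; rewrite -[X in polymap X]/(fun x => f x).
under eq_fun do rewrite [f _]matrix_sum_delta.
apply: polymap_sum => i _; apply: polymap_sum => j _.
by apply: polymapZ => //; apply: polymap_cst.
Qed.

Lemma polyfun_entry_comp E m n (f : E -> 'M[F]_(m, n)) i j :
  polymap f -> polyfun (fun x => f x i j).
Proof. exact: (polyfun_comp (polyfun_entry i j)). Qed.

Lemma polymapM E m n p (f : E -> 'M[F]_(m, n)) (g : E -> 'M[F]_(n, p)) :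
  polymap f -> polymap g -> polymap (fun x => f x *m g x).
Proof.
move=> pf pg; apply: polymap_entries => i j; under eq_fun do rewrite mxE.
by apply: polyfun_sum => k _; apply: polyfunM; apply: polyfun_entry_comp.
Qed.

Lemma polymap_regular E E' (A : set E) (B : set E') (f : E -> E') :
  polymap f -> (forall x, A x -> B (f x)) -> regular_map A B f.
Proof.
move=> pf AB; split=> //; have [q Hq] := fin_all_exists pf.
by exists q => x _ i; apply: Hq.
Qed.

Lemma zariski_closed_eq E E' (A : set E) (f g : E -> E') :
    polymap f -> polymap g -> zariski_closed A ->
  zariski_closed (A `&` [set x | f x = g x]).
Proof.
move=> pf pg [I ->]; have [q Hq] := fin_all_exists (polymapB pf pg).
exists (I `|` [set p | exists i, p = q i]); apply/seteqP; split => x /=.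
  move=> [Ix fg] p [/Ix //|[i ->]].
  by rewrite -Hq fg subrr /coords linear0.
move=> Hx; split=> [p Ip|]; first by apply: Hx; left.
apply/eqP; rewrite -subr_eq0 [_ - _]vect_coordsE; apply/eqP.
rewrite big1 // => i _; rewrite Hq Hx ?scale0r //.
by right; exists i.
Qed.

End PolynomialMaps.

(** The family is the specialization of one matrix [MB] over the polynomial ring. Any point of this
    ring specializes [MB] to [M q], where [q] lists the images of the variables, so freeness for all
    [q] is the condition of [unimodular_matrix]. *)
Lemma linear_family_completion (F : numClosedFieldType) r N m
    (D : 'M[F]_(r, N)) (L : 'I_m -> 'M[F]_(r, N)) (M : 'rV[F]_m -> 'M[F]_(r, N)) :
    (forall q, M q = D + \sum_i q 0 i *: L i) ->
    (forall q, row_free (M q)) ->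
  exists k (K : 'rV_m -> 'M[F]_(k, N)) (P : 'rV_m -> 'M_(N, r)) (Q : 'rV_m -> 'M_(N, k)),
    [/\ (r + k = N)%N, polymap K, polymap P & polymap Q] /\
    forall q, [/\ P q *m M q + Q q *m K q = 1%:M, M q *m P q = 1%:M,
       K q *m Q q = 1%:M, M q *m Q q = 0 & K q *m P q = 0].
Proof.
move=> defM freeM.
have [B [emb [X [ev [[urtB _] pt evX closedB]]]]] :=
  polynomial_rings (fun i (q : 'rV[F]_m) => q 0 i).
pose MB := map_mx emb D + \sum_i X i *: map_mx emb (L i).
have evMB (e : {rmorphism B -> F}) : point emb e ->
    map_mx e MB = M (\row_i e (X i)).
  move=> pe; have e_emb p q (A : 'M[F]_(p, q)) : map_mx e (map_mx emb A) = A.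
    by apply/matrixP=> i j; rewrite !mxE pe.
  rewrite defM /MB map_mxD e_emb; congr (_ + _).
  rewrite raddf_sum; apply: eq_bigr => i _; rewrite /= mxE map_mxZ; congr (_ *: _).
  exact: e_emb.
have [|k [K [P [Q [rk PMQK MP KQ [MQ KP]]]]]] := unimodular_matrix (M := MB) urtB.
  by move=> e pe; rewrite evMB.
have evM q : map_mx (ev q) MB = M q.
  rewrite evMB //; congr M; apply/rowP=> i.
  by rewrite mxE evX.
have poly_ev p q (A : 'M[B]_(p, q)) : polymap (fun x => map_mx (ev x) A).
  apply: polymap_entries => i j; under eq_fun do rewrite mxE.
  apply: closedB => *.
  - exact: polyfun_cst.
  - exact: polyfun_entry.
  - exact: polyfunD.
  - exact: polyfunM.
exists k, (fun q => map_mx (ev q) K), (fun q => map_mx (ev q) P), (fun q => map_mx (ev q) Q).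
split=> // q; rewrite -!evM -!map_mxM -map_mxD.
by rewrite PMQK MP KQ MQ KP !map_mx1 !map_mx0.
Qed.

(** * The exponential of strictly upper triangular matrices *)

Section Exponential.
Variables (F : numFieldType) (n : nat).
Implicit Types X Y Z A D : 'M[F]_n.

(** The matrices supported on the d-th superdiagonal and above it: a multiplicative filtration, in
    which [upper 1] means strictly upper triangular. *)
Definition upper (d : nat) A : Prop := forall i j : 'I_n, (j < i + d)%N -> A i j = 0.

Lemma upper_le c d A : (c <= d)%N -> upper d A -> upper c A.
Proof. by move=> cd uA i j ij; apply: uA; lia. Qed.

Lemma upperD d A D : upper d A -> upper d D -> upper d (A + D).
Proof. by move=> uA uD i j ij; rewrite mxE uA ?uD ?addr0. Qed.

Lemma upperZ d a A : upper d A -> upper d (a *: A).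
Proof. by move=> uA i j ij; rewrite mxE uA ?mulr0. Qed.

Lemma upperN d A : upper d A -> upper d (- A).
Proof. by rewrite -scaleN1r; apply: upperZ. Qed.

Lemma upperB d A D : upper d A -> upper d D -> upper d (A - D).
Proof. by move=> uA uD; apply: upperD => //; apply: upperN. Qed.

Lemma upper0 d : upper d 0.
Proof. by move=> i j _; rewrite mxE. Qed.

Lemma upper_sum d I (r : seq I) (P : pred I) (f : I -> 'M[F]_n) :
  (forall i, P i -> upper d (f i)) -> upper d (\sum_(i <- r | P i) f i).
Proof. by move=> uf; elim/big_ind: _ => //; [apply: upper0 | apply: upperD]. Qed.

Lemma upperM c d A D : upper c A -> upper d D -> upper (c + d) (A * D).
Proof.
move=> uA uD i j ij; rewrite mxE big1 // => k _.
have [ik|ik] := ltnP k (i + c); first by rewrite uA ?mul0r.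
by rewrite uD ?mulr0 //; lia.
Qed.

Lemma upper_ge d A : (n <= d)%N -> upper d A -> A = 0.
Proof.
move=> nd uA; apply/matrixP=> i j; rewrite mxE uA //.
by apply: leq_trans (ltn_ord j) _; lia.
Qed.

Lemma upper1 : upper 0 1.
Proof. by move=> i j ij; rewrite mxE; case: eqP ij => // ->; lia. Qed.

Lemma upper_exp X k : upper 1 X -> upper k (X ^+ k).
Proof.
move=> uX; elim: k => [|k IHk]; first exact: upper1.
by rewrite exprS -add1n; apply: upperM.
Qed.

Lemma upper_exp_eq0 X k : (n <= k)%N -> upper 1 X -> X ^+ k = 0.
Proof. by move=> nk uX; apply: (upper_ge nk); apply: upper_exp. Qed.

(* Two terms more than nilpotency requires, so that 1 + X is always explicit. *)
Definition mexp X : 'M[F]_n := \sum_(k < n.+2) (k`!%:R)^-1 *: X ^+ k.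

(* Newton iteration: each step improves exp X = A by one superdiagonal. *)
Definition mlog A : 'M[F]_n := iter n (fun X => X + A - mexp X) 0.

Lemma expmxZ t X k : (t *: X) ^+ k = t ^+ k *: X ^+ k.
Proof.
elim: k => [|k IHk]; first by rewrite !expr0 scale1r.
by rewrite !exprS IHk -mulmxE -scalemxAl -scalemxAr scalerA.
Qed.

Lemma mexp0 : mexp 0 = 1.
Proof.
rewrite /mexp big_ord_recl big1 => [|i _]; last by rewrite expr0n scaler0.
by rewrite invr1 scale1r addr0.
Qed.

Lemma upper_exp_diff d X D k : upper 1 X -> upper d.+1 D ->
  upper (d.+1 + k) ((X + D) ^+ k.+1 - X ^+ k.+1).
Proof.
move=> uX uD; have uXD : upper 1 (X + D).
  by apply: upperD => //; apply: upper_le uD.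
elim: k => [|k IHk]; first by rewrite !expr1 addrAC subrr add0r addn0.
have -> : (X + D) ^+ k.+2 - X ^+ k.+2 =
    (X + D) * ((X + D) ^+ k.+1 - X ^+ k.+1) + D * X ^+ k.+1.
  by rewrite mulrBr -exprS [(X + D) * X ^+ _]mulrDl -exprS opprD addrA subrK.
apply: upperD.
  by rewrite (_ : (d.+1 + k.+1 = 1 + (d.+1 + k))%N); [apply: upperM | lia].
by apply: upperM => //; apply: upper_exp.
Qed.

(** To first order in the filtration the exponential is the identity: in the terms of degree at
    least two, a perturbation of depth d + 1 gets at least one superdiagonal deeper. *)
Lemma mexp_diff d X D : upper 1 X -> upper d.+1 D ->
  upper d.+2 (mexp (X + D) - mexp X - D).
Proof.
move=> uX uD; rewrite /mexp -sumrB !big_ord_recl /= !expr0 !expr1 !invr1 !scale1r.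
rewrite subrr add0r (addrAC X) subrr add0r addrAC subrr add0r.
apply: upper_sum => i _; rewrite -scalerBr; apply: upperZ.
apply: (@upper_le _ (d.+1 + i.+1)); first by lia.
exact: upper_exp_diff.
Qed.

Lemma mexp_upper X : upper 1 X -> upper 1 (mexp X - 1).
Proof.
move=> uX; have := mexp_diff (@upper0 1) uX; rewrite add0r mexp0 => uE.
by rewrite -[_ - 1](subrK X); apply: upperD => //; apply: upper_le uE.
Qed.

Lemma mexp_inj X Y : upper 1 X -> upper 1 Y -> mexp X = mexp Y -> X = Y.
Proof.
move=> uX uY eqE; apply/eqP; rewrite -subr_eq0; apply/eqP.
suff uXY d : upper d.+1 (X - Y) by apply: upper_ge (uXY n).
elim: d => [|d IHd]; first exact: upperB.
have := mexp_diff uY IHd; rewrite (addrC Y) subrK eqE subrr sub0r.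
by move=> /upperN; rewrite opprK.
Qed.

Lemma mlog_iter A k (Xk := iter k (fun X => X + A - mexp X) 0) :
  upper 1 (A - 1) -> upper 1 Xk /\ upper k.+1 (A - mexp Xk).
Proof.
move=> uA; rewrite {}/Xk; elim: k => [|k [uX uAX]] /=.
  by split; [apply: upper0 | rewrite mexp0].
set X := iter k _ _ in uX uAX *; rewrite -addrA; split.
  by apply: upperD => //; apply: upper_le uAX.
have := upperN (mexp_diff uX uAX).
set M := mexp (_ + _).
by rewrite (_ : - (M - mexp X - (A - mexp X)) = A - M) // opprB opprB addrA subrK.
Qed.

Lemma upper_mlog A : upper 1 (A - 1) -> upper 1 (mlog A).
Proof. by move=> /(mlog_iter n)[]. Qed.

Lemma mlogK A : upper 1 (A - 1) -> mexp (mlog A) = A.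
Proof.
move=> /(mlog_iter n)[_ /upper_ge]; rewrite leqnSn => /(_ isT) /eqP.
by rewrite subr_eq0 => /eqP.
Qed.

Lemma mexpK X : upper 1 X -> mlog (mexp X) = X.
Proof.
move=> uX; have uE := mexp_upper uX.
by apply: mexp_inj; rewrite ?mlogK //; apply: upper_mlog.
Qed.

(** * Linear differential equations and the Campbell-Hausdorff formula *)

Definition mxderiv (A : 'M[{poly F}]_n) : 'M[{poly F}]_n := map_mx (@deriv F) A.

Lemma mxderivM (A B : 'M[{poly F}]_n) :
  mxderiv (A *m B) = mxderiv A *m B + A *m mxderiv B.
Proof.
apply/matrixP=> i j; rewrite !mxE raddf_sum -big_split; apply: eq_bigr => k _ /=.
by rewrite derivM !mxE.
Qed.

Lemma mxderivD (A B : 'M[{poly F}]_n) : mxderiv (A + B) = mxderiv A + mxderiv B.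
Proof. by rewrite /mxderiv map_mxD. Qed.

Lemma mxderiv_const A : mxderiv (map_mx polyC A) = 0.
Proof. by apply/matrixP=> i j; rewrite !mxE derivC. Qed.

(** Comparison of coefficients: k + 1 times the coefficient of degree k + 1 of [A] is a combination
    of those of degree at most k, and k + 1 is invertible in characteristic 0. *)
Lemma linear_ode_zero (C A : 'M[{poly F}]_n) :
  mxderiv A = C *m A -> map_mx (horner_eval 0) A = 0 -> A = 0.
Proof.
move=> dA A0; suff coefA k : forall l, (l <= k)%N -> forall i j, (A i j)`_l = 0.
  by apply/matrixP=> i j; apply/polyP=> l; rewrite (coefA l) // mxE coef0.
elim: k => [|k IHk] l.
  rewrite leqn0 => /eqP -> i j; have /matrixP/(_ i j) := A0.
  by rewrite !mxE /horner_eval horner_coef0.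
rewrite leq_eqVlt => /orP[/eqP -> i j|]; last exact: IHk.
have /matrixP/(_ i j)/polyP/(_ k) := dA; rewrite !mxE coef_deriv coef_sum.
rewrite big1 => [/eqP|m _]; last first.
  by rewrite coefM big1 // => p _; rewrite IHk ?mulr0 ?leq_subr.
by rewrite -mulr_natr mulf_eq0 pnatr_eq0 orbF => /eqP.
Qed.

Lemma linear_ode_unique (C A B : 'M[{poly F}]_n) :
    mxderiv A = C *m A -> mxderiv B = C *m B ->
    map_mx (horner_eval 0) A = map_mx (horner_eval 0) B -> A = B.
Proof.
move=> dA dB AB0; apply/eqP; rewrite -subr_eq0; apply/eqP.
apply: (@linear_ode_zero C); last by rewrite map_mxB AB0 subrr.
by rewrite /mxderiv map_mxB -/(mxderiv A) -/(mxderiv B) dA dB mulmxBr.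
Qed.

(* The one-parameter group t |-> exp (t X), with t the polynomial variable. *)
Definition mexp_curve X : 'M[{poly F}]_n :=
  \sum_(k < n.+2) ((k`!%:R)^-1 *: 'X^k) *: map_mx polyC (X ^+ k).

Lemma mexp_curve_eval X t : map_mx (horner_eval t) (mexp_curve X) = mexp (t *: X).
Proof.
apply/matrixP=> i j; rewrite /mexp /mexp_curve !mxE !summxE /horner_eval horner_sum.
apply: eq_bigr => k _; rewrite expmxZ !mxE.
by rewrite hornerM hornerZ hornerXn hornerC mulrA.
Qed.

Lemma mexp_curve_deriv X : upper 1 X ->
  mxderiv (mexp_curve X) = map_mx polyC X *m mexp_curve X.
Proof.
move=> uX; rewrite /mxderiv /mexp_curve raddf_sum big_ord_recl mulmx_sumr [RHS]big_ord_recr /=.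
have -> : map_mx (@deriv F) (((0`!%:R)^-1 *: 'X^0) *: map_mx polyC (X ^+ 0)) = 0.
  apply/matrixP=> i j; rewrite !mxE invr1 scale1r expr0 mul1r derivC //.
(* The last term on the right contains [X ^+ n.+2], which vanishes; the others match those on the
   left after a shift of the index. *)
rewrite add0r -scalemxAr -map_mxM -[X *m _]exprS upper_exp_eq0 //; last by lia.
rewrite map_mx0 scaler0 addr0; apply: eq_bigr => k _.
rewrite -scalemxAr -map_mxM -[X *m _]exprS.
apply/matrixP=> i j; rewrite !mxE derivM derivC mulr0 addr0; congr (_ * _).
rewrite derivZ derivXn /= -scalerMnr scalerMnl -mulr_natl; congr (_ *: _).
rewrite /bump /= add1n factS natrM invfM mulrA mulfV ?mul1r //.
by rewrite pnatr_eq0.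
Qed.

Lemma mexp_curve0 X : map_mx (horner_eval 0) (mexp_curve X) = 1%:M.
Proof. by rewrite mexp_curve_eval scale0r mexp0. Qed.

Lemma map_horner_const t A : map_mx (horner_eval t) (map_mx polyC A) = A.
Proof. by apply/matrixP=> i j; rewrite !mxE /horner_eval hornerC. Qed.

(** Conjugation by exp (t X) sends Y to Y + t [X, Y] when [X, Y] commutes with X: both sides solve
    A' = X A with initial value Y. *)
Lemma mexp_curve_commut X Y Z : upper 1 X -> X * Y - Y * X = Z -> X * Z = Z * X ->
  mexp_curve X *m map_mx polyC Y =
  (map_mx polyC Y + 'X *: map_mx polyC Z) *m mexp_curve X.
Proof.
move=> uX defZ XZ; apply: (@linear_ode_unique (map_mx polyC X)).
- by rewrite mxderivM mxderiv_const mulmx0 addr0 mexp_curve_deriv // mulmxA.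
- rewrite mxderivM mxderivD mxderiv_const add0r mexp_curve_deriv //.
  have -> : mxderiv ('X *: map_mx polyC Z) = map_mx polyC Z.
    apply/matrixP=> i j; rewrite !mxE derivM derivX derivC mul1r mulr0.
    by rewrite addr0.
  rewrite !mulmxA -mulmxDl; congr (_ *m _).
  rewrite mulmxDr mulmxDl -scalemxAl -scalemxAr addrA -!map_mxM; congr (_ + _ *: _).
    by rewrite -map_mxD -defZ !mulmxE subrK.
  by rewrite !mulmxE XZ.
rewrite !map_mxM map_mxD map_mxZ /= !map_horner_const mexp_curve0 /horner_eval.
by rewrite hornerX scale0r addr0 mulmx1 mul1mx.
Qed.

(* exp (t X) exp (t Y) and exp (t^2 Z / 2) exp (t (X + Y)) solve the same linear
   differential equation. *)
Lemma mexp_bch X Y Z : upper 1 X -> upper 1 Y -> X * Y - Y * X = Z ->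
    X * Z = Z * X -> Y * Z = Z * Y ->
  mexp X * mexp Y = mexp (X + Y + 2^-1 *: Z).
Proof.
pose h : {poly F} := 2^-1 *: 'X^2.
have dh : deriv h = 'X.
  by rewrite /h derivZ derivXn -scalerMnr scalerMnl -mulr_natr mulVf ?scale1r ?pnatr_eq0.
(* The differential equation gives a product of two exponentials. As Z / 2 commutes with X + Y, a
   second use of [step], with bracket 0, merges them. *)
have step X' Y' Z' : upper 1 X' -> upper 1 Y' -> X' * Y' - Y' * X' = Z' ->
    X' * Z' = Z' * X' -> Y' * Z' = Z' * Y' ->
    mexp X' * mexp Y' = mexp (2^-1 *: Z') * mexp (X' + Y').
  move=> uX uY defZ XZ YZ; have uXY := upperD uX uY.
  have uZ : upper 1 Z'.
    by rewrite -defZ; apply: upperB; (apply: upper_le; last by apply: upperM; eassumption).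
  pose EZ := map_mx (comp_poly h) (mexp_curve Z').
  have EZ_eval t : map_mx (horner_eval t) EZ = map_mx (horner_eval h.[t]) (mexp_curve Z').
    by apply/matrixP=> i j; rewrite !mxE /horner_eval horner_comp.
  have dEZ : mxderiv EZ = 'X *: (map_mx polyC Z' *m EZ).
    have -> : mxderiv EZ = 'X *: map_mx (comp_poly h) (mxderiv (mexp_curve Z')).
      by apply/matrixP=> i j; rewrite !mxE deriv_comp dh mulrC.
    rewrite mexp_curve_deriv // map_mxM; congr (_ *: (_ *m _)).
    by apply/matrixP=> i j; rewrite !mxE /= comp_polyC.
  have curves : mexp_curve X' *m mexp_curve Y' = EZ *m mexp_curve (X' + Y').
    apply: (@linear_ode_unique (map_mx polyC (X' + Y') + 'X *: map_mx polyC Z')).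
    - rewrite mxderivM !mexp_curve_deriv // [X in _ + X]mulmxA (mexp_curve_commut _ defZ) //.
      by rewrite mulmxA -mulmxDl -!mulmxA -mulmxDl map_mxD addrA /= mulmxA.
    - have EZ_commut : EZ *m map_mx polyC (X' + Y') = map_mx polyC (X' + Y') *m EZ.
        have := @mexp_curve_commut Z' (X' + Y') 0 uZ.
        rewrite mulr0 mul0r map_mx0 scaler0 addr0.
        rewrite mulrDr mulrDl -XZ -YZ subrr => /(_ erefl erefl).
        move=> /(congr1 (map_mx (comp_poly h))); rewrite !map_mxM.
        suff -> : map_mx (comp_poly h) (map_mx polyC (X' + Y')) = map_mx polyC (X' + Y') by [].
        by apply/matrixP=> i j; rewrite !mxE /= comp_polyC.
      rewrite mxderivM dEZ mexp_curve_deriv // mulmxA EZ_commut.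
      by rewrite mulmxDl addrC !mulmxA -!scalemxAl.
    by rewrite !map_mxM !mexp_curve0 EZ_eval /h hornerZ hornerXn expr0n mulr0 mexp_curve0.
  have /(congr1 (map_mx (horner_eval 1))) := curves.
  rewrite !map_mxM EZ_eval !mexp_curve_eval !scale1r.
  by rewrite /h hornerZ hornerXn expr1n mulr1.
move=> uX uY defZ XZ YZ; rewrite (step X Y Z) //.
have uZ : upper 1 Z.
  by rewrite -defZ; apply: upperB; (apply: upper_le; last by apply: upperM; eassumption).
rewrite (step _ _ 0) ?scaler0 ?mexp0 ?mul1r ?mulr0 ?mul0r //.
- by rewrite addrC.
- exact: upperZ.
- exact: upperD.
rewrite -!mulmxE -scalemxAl -scalemxAr mulmxDl mulmxDr !mulmxE -XZ -YZ.
by rewrite subrr.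
Qed.

End Exponential.

(** * The exponential and the logarithm as polynomial maps *)

Section PolynomialExp.
Variables (F : numFieldType) (n : nat).

Lemma polymap_expmx k : polymap (fun X : 'M[F]_n => X ^+ k).
Proof.
elim: k => [|k IHk]; first exact: polymap_cst.
under eq_fun do rewrite exprS.
by apply: polymapM => //; apply: polymap_id.
Qed.

Lemma polymap_mexp : polymap (@mexp F n).
Proof.
apply: polymap_sum => k _; apply: polymapZ; first exact: polyfun_cst.
exact: polymap_expmx.
Qed.

Lemma polymap_mlog : polymap (@mlog F n).
Proof.
rewrite /mlog; elim: (X in iter X) => [|k IHk] /=; first exact: polymap_cst.
apply: polymapB; last exact: (polymap_comp polymap_mexp IHk).
by apply: polymapD => //; apply: polymap_id.
Qed.

End PolynomialExp.

(** * The Lie algebra of a unipotent group *)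

Section ChainRule.
Variable F : numFieldType.

Lemma poly_nat_eq0 (p : {poly F}) : (forall k : nat, p.[k%:R] = 0) -> p = 0.
Proof.
move=> p0; apply: contrapT => /eqP nz_p.
pose zs := [seq k%:R : F | k <- iota 0 (size p)].
have : (size zs < size p)%N.
  apply: max_poly_roots => //; first by apply/allP=> _ /mapP[k _ ->]; apply/rootP.
  by rewrite map_inj_uniq ?iota_uniq // => k l /eqP; rewrite eqr_nat => /eqP.
by rewrite size_map size_iota ltnn.
Qed.

Lemma poly_fun_inj (p q : {poly F}) : (forall t, p.[t] = q.[t]) -> p = q.
Proof.
move=> pq; apply/eqP; rewrite -subr_eq0; apply/eqP; apply: poly_nat_eq0 => k.
by rewrite hornerD hornerN pq subrr.
Qed.

Lemma mpoly_gen_ind m (P : mpoly.mpoly m F -> Prop) :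
    (forall c, P (mpoly.mpolyC m c)) -> (forall i, P (mpoly.mpolyX F (mpoly.mnm1 i))) ->
    (forall p q, P p -> P q -> P (p + q)) -> (forall p q, P p -> P q -> P (p * q)) ->
  forall p, P p.
Proof.
move=> PC PX PD PM p; rewrite [p]mpoly.mpolyE.
apply: big_ind => [|p1 p2|d _]; [exact: (PC 0) | exact: PD |].
rewrite -mpoly.mul_mpolyC; apply: (PM) => //; rewrite mpoly.mpolyXE_id.
apply: big_ind => [|p1 p2|i _]; [exact: (PC 1) | exact: PM |].
by elim: (d i) => [|k IHk]; [apply: (PC 1) | rewrite exprS; apply: (PM)].
Qed.

(** [P] is [p] along the polynomial curve [c], whose velocity is [d]; by induction on the
    construction of [p] from constants and variables. *)
Lemma chain_rule (E : vectType F) (c d : F -> E) (cp : 'I_(\dim {: E}) -> {poly F}) :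
    (forall t i, coords (c t) i = (cp i).[t]) ->
    (forall t i, coords (d t) i = (cp i)^`().[t]) ->
  forall p, exists P : {poly F},
    forall t, P.[t] = peval p (c t) /\ P^`().[t] = pdiff p (c t) (d t).
Proof.
move=> Hc Hd; apply: mpoly_gen_ind => [a|i|p q [P HP] [Q HQ]|p q [P HP] [Q HQ]].
- exists a%:P => t; rewrite hornerC derivC horner0 /peval mpoly.mevalC /pdiff; split=> //.
  by rewrite big1 // => i _; rewrite mpoly.mderivC mpoly.meval0 mul0r.
- exists (cp i) => t; rewrite /peval mpoly.mevalXU Hc; split=> //.
  rewrite /pdiff (bigD1 i) //= big1 => [|j nji]; rewrite mpoly.mderivX mpoly.mnm1E.
    rewrite eqxx -Hd (_ : mpoly.mnm_sub _ _ = mpoly.mnm0) ?mpoly.mpolyX0.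
      by rewrite scale1r mpoly.meval1 mul1r addr0.
    by apply/mpoly.mnmP=> j; rewrite mpoly.mnmBE mpoly.mnm0E subnn.
  by rewrite eq_sym (negPf nji) scale0r mpoly.meval0 mul0r.
- exists (P + Q) => t; have [Pt P't] := HP t; have [Qt Q't] := HQ t.
  rewrite derivD !hornerD Pt Qt P't Q't /peval mpoly.mevalD; split=> //.
  rewrite /pdiff -big_split; apply: eq_bigr => i _ /=.
  by rewrite mpoly.mderivD mpoly.mevalD mulrDl.
exists (P * Q) => t; have [Pt P't] := HP t; have [Qt Q't] := HQ t.
rewrite derivM hornerD !hornerM Pt Qt P't Q't /peval mpoly.mevalM; split=> //.
rewrite /pdiff mulr_suml mulr_sumr -big_split; apply: eq_bigr => i _ /=.
rewrite mpoly.mderivM mpoly.mevalD !mpoly.mevalM; ring.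
Qed.

Variable n : nat.

Lemma matrix_chain_rule (C : 'M[{poly F}]_n) p : exists P : {poly F},
  forall t, P.[t] = peval p (map_mx (horner_eval t) C) /\
    P^`().[t] = pdiff p (map_mx (horner_eval t) C) (map_mx (horner_eval t) (mxderiv C)).
Proof.
pose cp i : {poly F} := \sum_j \sum_k (coords (delta_mx j k : 'M[F]_n) i) *: C j k.
apply: (chain_rule (cp := cp)) => t i.
  rewrite /coords [X in coord _ _ X]matrix_sum_delta !linear_sum horner_sum.
  apply: eq_bigr => j _; rewrite linear_sum horner_sum; apply: eq_bigr => k _.
  by rewrite linearZ hornerZ mxE mulrC.
rewrite /coords [X in coord _ _ X]matrix_sum_delta !linear_sum horner_sum.
apply: eq_bigr => j _; rewrite !linear_sum horner_sum; apply: eq_bigr => k _.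
by rewrite !linearZ /= hornerZ !mxE mulrC.
Qed.

Lemma line_chain_rule (Y X : 'M[F]_n) p : exists P : {poly F},
  forall t, P.[t] = peval p (Y + t *: X) /\ P^`().[t] = pdiff p (Y + t *: X) X.
Proof.
have [P HP] := matrix_chain_rule (map_mx polyC Y + 'X *: map_mx polyC X) p.
exists P => t; have [-> ->] := HP t.
have -> : map_mx (horner_eval t) (map_mx polyC Y + 'X *: map_mx polyC X) = Y + t *: X.
  by apply/matrixP=> i j; rewrite !mxE /horner_eval hornerD hornerM hornerX !hornerC.
split=> //; congr pdiff; apply/matrixP=> i j.
by rewrite !mxE /horner_eval derivD derivC derivM derivX derivC mul1r mulr0 addr0 add0r hornerC.
Qed.

End ChainRule.

Section LieAlgebra.
Variables (F : numFieldType) (n : nat).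
Implicit Types (G : set 'M[F]_n) (X Y : 'M[F]_n).

Lemma upper_unitriangularP (A : 'M[F]_n) : upper_unitriangular A <-> upper 1 (A - 1).
Proof.
split=> [[/is_trig_mxP trigA A1] i j|uA].
  rewrite addn1 ltnS leq_eqVlt !mxE => /orP[/eqP/val_inj ->|ji].
    by rewrite A1 eqxx subrr.
  have := trigA _ _ ji; rewrite mxE => ->.
  by rewrite sub0r; case: eqP ji => [->|_]; rewrite ?ltnn ?oppr0.
split; [apply/is_trig_mxP => i j ij; rewrite mxE | move=> i].
  have /eqP := uA j i ltac:(lia); rewrite !mxE subr_eq0 => /eqP ->.
  by case: eqP ij => [->|//]; rewrite ltnn.
have /eqP := uA i i ltac:(lia); rewrite !mxE subr_eq0 => /eqP ->.
by rewrite eqxx.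
Qed.

Section Group.
Variables (G : set 'M[F]_n) (uniG : unipotent_group G).

Lemma unipotent_upper A : G A -> upper 1 (A - 1).
Proof. by case: uniG => _ uG /uG/upper_unitriangularP. Qed.

Lemma unipotent1 : G 1%:M.
Proof. by case: uniG => -[[]]. Qed.

Lemma unipotentM A B : G A -> G B -> G (A *m B).
Proof. by case: uniG => -[[_ GM _] _] _; apply: GM. Qed.

Lemma unipotent_closed A : (forall p, vanishing_ideal G p -> peval p A = 0) -> G A.
Proof.
by case: uniG => -[_ [I ->]] _ GA p Ip; apply: GA => x; apply.
Qed.

(** On and below the diagonal, the entries of A - 1 are affine functions that vanish on G; their
    differentials are the entries of X. *)
Lemma lie_upper X : X \in lie_algebra G -> upper 1 X.
Proof.
move=> /tangent_spaceP TX i j ij.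
have [p Hp] : polyfun (fun A : 'M[F]_n => A i j - (1 : 'M[F]_n) i j).
  apply: polyfunD; first exact: polyfun_entry.
  exact: polyfun_cst.
have [P HP] := line_chain_rule 1 X p.
have -> : X i j = pdiff p 1 X.
  have [_] := HP 0; rewrite scale0r addr0 => <-.
  have -> : P = (X i j) *: 'X.
    apply: poly_fun_inj => t; have [-> _] := HP t.
    rewrite -Hp !mxE hornerZ hornerX; ring.
  by rewrite derivZ derivX hornerZ hornerC mulr1.
apply: TX => A /unipotent_upper uA; rewrite -Hp.
by have := uA i j ij; rewrite !mxE.
Qed.

(* p1 is the derivative of p along the left-invariant vector field X, so that
   d/dt p (exp (t X)) = p1 (exp (t X)). *)
Lemma vanishing_ideal_invariant X p : X \in lie_algebra G -> vanishing_ideal G p ->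
  exists2 p1, vanishing_ideal G p1 & forall Y, peval p1 Y = pdiff p Y (Y *m X).
Proof.
move=> /tangent_spaceP TX Ip.
have [p1 Hp1] : polyfun (fun Y : 'M[F]_n => pdiff p Y (Y *m X)).
  apply: polyfun_sum => i _; apply: polyfunM.
    by exists (mpoly.mderiv i p).
  have : polymap (fun Y : 'M[F]_n => Y *m X).
    by apply: polymapM; [apply: polymap_id | apply: polymap_cst].
  exact.
exists p1 => // Y GY; rewrite -Hp1.
have [q Hq] : polyfun (fun A : 'M[F]_n => peval p (Y *m A)).
  apply: (polyfun_comp (f := peval p)); first by exists p.
  by apply: polymapM; [apply: polymap_cst | apply: polymap_id].
have [P HP] := line_chain_rule Y (Y *m X) p.
have [Q HQ] := line_chain_rule 1 X q.
have PQ : P = Q.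
  apply: poly_fun_inj => t; have [-> _] := HP t; have [-> _] := HQ t.
  by rewrite -Hq mulmxDr mulmx1 -scalemxAr.
have [_] := HP 0; have [_] := HQ 0; rewrite PQ !scale0r !addr0 => -> <-.
by apply: TX => A GA; rewrite -Hq; apply: Ip; apply: unipotentM.
Qed.

(** For [p] in the ideal of G, the derivative of the polynomial p (exp (t X)) in t is of the same
    form with another element of the ideal. By induction all its coefficients vanish, the constant
    one being p (1) = 0. *)
Lemma lie_exp X : X \in lie_algebra G -> G (mexp X).
Proof.
move=> gX; have uX := lie_upper gX; apply: unipotent_closed => p Ip.
have curveX t : map_mx (horner_eval t) (mxderiv (mexp_curve X)) = mexp (t *: X) *m X.
  rewrite mexp_curve_deriv // -mexp_curve_eval.
  have := @mexp_curve_commut _ _ X X 0 uX; rewrite subrr mulr0 mul0r => /(_ erefl erefl).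
  by rewrite map_mx0 scaler0 addr0 => <-; rewrite map_mxM /= map_horner_const.
suff coefP k : forall q, vanishing_ideal G q -> forall P : {poly F},
    (forall t, P.[t] = peval q (mexp (t *: X))) -> P`_k = 0.
  have [P HP] := matrix_chain_rule (mexp_curve X) p.
  have {}HP t : P.[t] = peval p (mexp (t *: X)).
    by have [-> _] := HP t; rewrite mexp_curve_eval.
  rewrite -[X]scale1r -HP (_ : P = 0) ?horner0 //.
  by apply/polyP=> k; rewrite coef0 (coefP k p).
elim: k => [|k IHk] q Iq P HP.
  by rewrite -horner_coef0 HP scale0r mexp0; apply: Iq; apply: unipotent1.
have [q1 Iq1 Hq1] := vanishing_ideal_invariant gX Iq.
have [Q HQ] := matrix_chain_rule (mexp_curve X) q.
have PQ : P = Q.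
  by apply: poly_fun_inj => t; have [-> _] := HQ t; rewrite mexp_curve_eval.
have /eqP : P^`()`_k = 0.
  apply: (IHk q1) => // t; have [_] := HQ t.
  by rewrite PQ => ->; rewrite curveX mexp_curve_eval Hq1.
by rewrite coef_deriv -mulr_natr mulf_eq0 pnatr_eq0 orbF => /eqP.
Qed.

Lemma mexp_natmul X k : upper 1 X -> mexp (k%:R *: X) = mexp X ^+ k.
Proof.
move=> uX; elim: k => [|k IHk]; first by rewrite scale0r mexp0.
have com : X * (k%:R *: X) = k%:R *: X * X by rewrite -!mulmxE -scalemxAl -scalemxAr.
rewrite exprS -IHk (@mexp_bch _ _ _ _ 0) ?mulr0 ?mul0r //.
- by rewrite scaler0 addr0 -[k.+1]add1n natrD scalerDl scale1r.
- exact: upperZ.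
by rewrite com subrr.
Qed.

(** The polynomial p (exp (t log A)) vanishes at each natural t, where the argument is a power of A;
    so it is zero, and its derivative at 0 is the differential of [p] at the identity along log
    A. *)
Lemma lie_log A : G A -> mlog A \in lie_algebra G.
Proof.
move=> GA; have uA := unipotent_upper GA; have uX := upper_mlog uA.
apply/tangent_spaceP => p Ip.
have [P HP] := matrix_chain_rule (mexp_curve (mlog A)) p.
have P0 : P = 0.
  apply: poly_nat_eq0 => k; have [-> _] := HP k%:R.
  rewrite mexp_curve_eval mexp_natmul // mlogK //; apply: Ip.
  elim: k => [|k IHk]; first exact: unipotent1.
  by rewrite exprS; apply: unipotentM.
have [_] := HP 0; rewrite mexp_curve_deriv // map_mxM /= map_horner_const.
by rewrite mexp_curve_eval scale0r mexp0 mulmx1 P0 deriv0 horner0.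
Qed.

End Group.
End LieAlgebra.

(** * The Lie bracket of matrices *)

Section Bracket.
Variables (F : fieldType) (n : nat).
Implicit Types X Y Z : 'M[F]_n.
Local Notation "[br X , Y ]" := (lie_bracket X Y) (at level 0, X, Y at level 99).

Lemma brDl X Y Z : [br X + Y, Z] = [br X, Z] + [br Y, Z].
Proof. by rewrite /lie_bracket mulmxDl mulmxDr opprD addrACA. Qed.

Lemma brNl X Y : [br - X, Y] = - [br X, Y].
Proof. by rewrite /lie_bracket mulNmx mulmxN opprB opprK addrC. Qed.

Lemma br_anti X Y : [br X, Y] = - [br Y, X].
Proof. by rewrite /lie_bracket opprB. Qed.

Lemma brDr X Y Z : [br X, Y + Z] = [br X, Y] + [br X, Z].
Proof. by rewrite br_anti brDl opprD -!br_anti. Qed.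

Lemma brNr X Y : [br X, - Y] = - [br X, Y].
Proof. by rewrite br_anti brNl -br_anti. Qed.

Lemma brZl a X Y : [br a *: X, Y] = a *: [br X, Y].
Proof. by rewrite /lie_bracket -scalemxAl -scalemxAr scalerBr. Qed.

Lemma brZr a X Y : [br X, a *: Y] = a *: [br X, Y].
Proof. by rewrite br_anti brZl -scalerN -br_anti. Qed.

Lemma brxx X : [br X, X] = 0.
Proof. by rewrite /lie_bracket subrr. Qed.

Lemma br_suml I (r : seq I) (P : pred I) (f : I -> 'M[F]_n) Y :
  [br \sum_(i <- r | P i) f i, Y] = \sum_(i <- r | P i) [br f i, Y].
Proof. by rewrite /lie_bracket mulmx_suml mulmx_sumr -sumrB. Qed.

Lemma br_sumr I (r : seq I) (P : pred I) (f : I -> 'M[F]_n) Y :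
  [br Y, \sum_(i <- r | P i) f i] = \sum_(i <- r | P i) [br Y, f i].
Proof. by rewrite /lie_bracket mulmx_suml mulmx_sumr -sumrB. Qed.

Lemma lie_prodP (U W : {vspace 'M[F]_n}) X Y :
  X \in U -> Y \in W -> [br X, Y] \in lie_prod U W.
Proof.
move=> UX WY; rewrite (coord_vbasis UX) (coord_vbasis WY) br_suml.
apply: memv_suml => i _; rewrite br_sumr; apply: memv_suml => j _.
rewrite brZl brZr !memvZ //; apply: memv_span.
by apply: allpairs_f; apply: mem_nth; rewrite size_tuple.
Qed.

Lemma lie_prod_sub (U W T : {vspace 'M[F]_n}) :
  (forall X Y, X \in U -> Y \in W -> [br X, Y] \in T) -> (lie_prod U W <= T)%VS.
Proof.
move=> UWT; apply/span_subvP => _ /allpairsP[[X Y] /= [UX WY ->]].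
by apply: UWT; apply: vbasis_mem.
Qed.

End Bracket.
Notation "[br X , Y ]" := (lie_bracket X Y) (at level 0, X, Y at level 99).

(** * Exponential calculus in a 2-step nilpotent Lie algebra *)

Section TwoStep.
Variables (F : numFieldType) (n : nat) (G : set 'M[F]_n).
Hypotheses (uniG : unipotent_group G) (nilG : step_nilpotent 2 (lie_algebra G)).
Local Notation g := (lie_algebra G).
Local Notation c := (lie_prod g g).
Implicit Types X Y Z : 'M[F]_n.

Lemma br_center X Z : X \in g -> Z \in c -> [br X, Z] = 0.
Proof.
move=> gX cZ; have [nil2 _] := nilG; apply/eqP; rewrite -memv0 -nil2.
exact: lie_prodP.
Qed.

Lemma mexp_mul X Y : X \in g -> Y \in g ->
  mexp X *m mexp Y = mexp (X + Y + 2^-1 *: [br X, Y]).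
Proof.
move=> gX gY; have cXY := lie_prodP gX gY.
apply: (@mexp_bch _ _ _ _ [br X, Y]) => //;
  try by [apply: (lie_upper uniG gX) | apply: (lie_upper uniG gY)].
  by apply/eqP; rewrite -subr_eq0; apply/eqP; apply: (br_center gX).
by apply/eqP; rewrite -subr_eq0; apply/eqP; apply: (br_center gY).
Qed.

Lemma mexp_mul_center X Z : X \in g -> Z \in g -> [br X, Z] = 0 ->
  mexp X *m mexp Z = mexp (X + Z).
Proof. by move=> gX gZ XZ; rewrite mexp_mul // XZ scaler0 addr0. Qed.

Lemma mexpV X : X \in g -> mexp X *m mexp (- X) = 1%:M.
Proof.
move=> gX; rewrite mexp_mul_center ?memvN // ?brNr ?brxx ?oppr0 //.
by rewrite subrr mexp0.
Qed.

Lemma mlog_mexp X : X \in g -> mlog (mexp X) = X.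
Proof. by move=> gX; apply: mexpK (lie_upper uniG gX). Qed.

Lemma mexp_mlog A : G A -> mexp (mlog A) = A.
Proof. by move=> GA; apply: mlogK (unipotent_upper uniG GA). Qed.

Lemma subgroup_unipotent V : algebraic_group V -> V `<=` G -> unipotent_group V.
Proof. by move=> hV VG; split=> // A /VG; case: uniG => _; apply. Qed.

Lemma lie_sub V X : algebraic_group V -> V `<=` G ->
  X \in lie_algebra V -> X \in g.
Proof.
move=> hV VG vX; have uniV := subgroup_unipotent hV VG.
rewrite -(mexpK (lie_upper uniV vX)); apply: (lie_log uniG).
by apply: VG; apply: (lie_exp uniV).
Qed.

(** The logarithm X + Y + [X, Y] / 2 of exp X exp Y lies in the Lie algebra of V, hence so does the
    bracket. *)
Lemma lie_br V X Y : algebraic_group V -> V `<=` G ->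
  X \in lie_algebra V -> Y \in lie_algebra V -> [br X, Y] \in lie_algebra V.
Proof.
move=> hV VG vX vY; have uniV := subgroup_unipotent hV VG.
have gX := lie_sub hV VG vX; have gY := lie_sub hV VG vY.
have VXY : V (mexp (X + Y + 2^-1 *: [br X, Y])).
  by rewrite -mexp_mul //; apply: (unipotentM uniV); apply: (lie_exp uniV).
have := lie_log uniV VXY; rewrite mexpK; last first.
  apply: upperD; first by apply: upperD; apply: (lie_upper uniG).
  apply: upperZ; apply: (@upper_le _ _ 1 (1 + 1)) => //.
  by apply: upperB; apply: upperM; apply: (lie_upper uniG).
set W := _ + _ => vW.
have -> : [br X, Y] = 2 *: (W - (X + Y)).
  by rewrite /W addrAC subrr add0r scalerA divff ?scale1r ?pnatr_eq0.
by rewrite memvZ // memvB // memvD.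
Qed.

Lemma center_sub Z : Z \in c -> Z \in g.
Proof.
apply/subvP/lie_prod_sub => X Y gX gY; apply: lie_br => //.
by case: uniG.
Qed.

End TwoStep.

(** * Projections and coordinates in subspaces *)

Section VspaceCoordinates.
Variables (F : fieldType) (E : vectType F).
Implicit Types U W : {vspace E}.

(** [addv_pi1 U W] is the projection of U + W onto the complement [U :\: W] of the intersection in
    U, along W. *)
Lemma addv_pi1_id U W x : x \in (U :\: W)%VS -> addv_pi1 U W x = x.
Proof. by apply: daddv_pi_id; apply: capv_diff. Qed.

Lemma addv_pi1_eq0 U W x : x \in W -> addv_pi1 U W x = 0.
Proof.
move=> Wx; have := @addv_pi1_pi2 _ _ U W x; rewrite (subvP (addvSr U W)) //.
rewrite addv_pi2_id // => /(_ isT)/(congr1 (fun y => y - x)).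
by rewrite addrK subrr.
Qed.

Lemma memv_pi1_diff U W x : addv_pi1 U W x \in (U :\: W)%VS.
Proof. exact: memv_pi. Qed.

Lemma memv_sub_pi1 U W x : x \in (U + W)%VS -> x - addv_pi1 U W x \in W.
Proof.
by move=> /addv_pi1_pi2 {1}<-; rewrite addrAC subrr add0r memv_pi2.
Qed.

Definition lincomb U (u : 'rV[F]_(\dim U)) : E := \sum_i u 0 i *: (vbasis U)`_i.

Definition coordrow U (x : E) : 'rV[F]_(\dim U) := \row_i coord (vbasis U) i x.

Lemma lincomb_mem U u : @lincomb U u \in U.
Proof. by apply: memv_suml => i _; rewrite memvZ // vbasis_mem // mem_nth // size_tuple. Qed.

Lemma coordrowK U x : x \in U -> lincomb (coordrow U x) = x.
Proof.
move=> Ux; rewrite [RHS](coord_vbasis Ux); apply: eq_bigr => i _.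
by rewrite mxE.
Qed.

Lemma lincombK U u : coordrow U (@lincomb U u) = u.
Proof.
apply/rowP=> i; rewrite mxE coord_sum_free //.
exact: basis_free (vbasisP U).
Qed.

Lemma lincomb0 U : @lincomb U 0 = 0.
Proof. by rewrite /lincomb big1 // => i _; rewrite mxE scale0r. Qed.

Lemma lincombD U u w : @lincomb U (u + w) = lincomb u + lincomb w.
Proof. by rewrite /lincomb -big_split; apply: eq_bigr => i _; rewrite mxE scalerDl. Qed.

Lemma lincombB U u w : @lincomb U (u - w) = lincomb u - lincomb w.
Proof. by apply: (addIr (lincomb w)); rewrite -lincombD !subrK. Qed.

Lemma polymap_lincomb (E' : vectType F) U (f : E' -> 'rV[F]_(\dim U)) :
  polymap f -> polymap (fun x => lincomb (f x)).
Proof.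
move=> pf; apply: polymap_sum => i _; apply: polymapZ; last exact: polymap_cst.
exact: polyfun_entry_comp.
Qed.

Lemma polymap_coordrow (E' : vectType F) U (f : E' -> E) :
  polymap f -> polymap (fun x => coordrow U (f x)).
Proof.
move=> pf; apply: polymap_entries => i j; under eq_fun do rewrite mxE.
apply: (polyfun_comp (f := coord (vbasis U) j)) => //.
by apply: linear_polyfun => a x y; rewrite linearP.
Qed.

End VspaceCoordinates.

(** * The slice *)

Section Slice.
Variables (F : numClosedFieldType) (n : nat) (G V H : set 'M[F]_n).
Hypotheses (uniG : unipotent_group G) (nilG : step_nilpotent 2 (lie_algebra G)).
Hypotheses (algV : algebraic_group V) (VG : V `<=` G).
Hypotheses (algH : algebraic_group H) (HG : H `<=` G).
Hypothesis freeVH : free_action G V H.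

Local Notation g := (lie_algebra G).
Local Notation v := (lie_algebra V).
Local Notation h := (lie_algebra H).
Local Notation c := (lie_prod g g).

Let uniV := subgroup_unipotent uniG algV VG.
Let uniH := subgroup_unipotent uniG algH HG.
Let gv X (vX : X \in v) : X \in g := lie_sub uniG algV VG vX.
Let gh X (hX : X \in h) : X \in g := lie_sub uniG algH HG hX.
Let gc X (cX : X \in c) : X \in g := center_sub uniG nilG cX.

Lemma bracket_center X Y : X \in g -> Y \in g -> [br X, Y] \in c.
Proof. exact: lie_prodP. Qed.

Lemma bracket_centerl X Y : X \in c -> Y \in g -> [br X, Y] = 0.
Proof. by move=> cX gY; rewrite br_anti (br_center nilG) ?oppr0. Qed.

(** Conjugation by exp X sends exp Y to exp (Y + [X, Y]). If this lies in V, then the pair it forms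
    with exp Y fixes the point exp X, and freeness gives Y = 0. *)
Lemma free_lie X Y : X \in g -> Y \in h -> Y + [br X, Y] \in v -> Y = 0.
Proof.
move=> gX hY vZ; set Z := Y + _ in vZ.
have gY := gh hY; have cXY := bracket_center gX gY.
have ZX : mexp Z *m mexp X = mexp X *m mexp Y.
  rewrite !(mexp_mul uniG nilG) //; last exact: gv.
  congr mexp; rewrite /Z brDl (bracket_centerl cXY gX) addr0 (br_anti Y X).
  by apply/matrixP=> i j; rewrite !mxE; field.
have VZ := lie_exp uniV vZ; have HY := lie_exp uniH hY; have GX := lie_exp uniG gX.
have [|_ Y1] := freeVH VZ HY GX.
  rewrite ZX -mulmxA mulmxV ?mulmx1 //.
  by case: algH => -[_ _ /(_ _ HY)[]].
by apply: (mexp_inj (lie_upper uniH hY) (@upper0 _ _ _)); rewrite Y1 mexp0.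
Qed.

Lemma cap_lie : (v :&: h)%VS = 0%VS.
Proof.
apply/eqP; rewrite -subv0; apply/subvP=> X; rewrite memv_cap memv0 => /andP[vX hX].
apply/eqP; apply: (@free_lie 0) => //; first exact: mem0v.
by rewrite /lie_bracket mul0mx mulmx0 subrr addr0.
Qed.

(* w projects onto the intersection of the images of v and h in g / [g, g],
   and x - beta x is the discrepancy between the lifts of the same class to v
   and to h. *)
Let wv := (v :&: (h + c))%VS.
Let w := (wv :\: c)%VS.
(** The central elements of V and H translate the fibre c by [d], and [c'] represents the quotient.
    Modulo c the orbits are the cosets of [u], represented by [m]; the order of the sum [u] is that
    in which [part_b] and [part_a] split off their components. *)
Let d := ((v :&: c) + (h :&: c))%VS.
Let c' := (c :\: d)%VS.
Let u := (h + (v + c))%VS.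
Let m := (g :\: u)%VS.
Let beta := addv_pi1 h c.

Definition shift (q x : 'M[F]_n) := x - beta x + [br x, q].

Let sub_dc X : X \in d -> X \in c.
Proof. by apply/subvP; rewrite subv_add !capvSr. Qed.

Let c'_sub X : X \in c' -> X \in c.
Proof. by apply/subvP/diffvSl. Qed.

Let m_sub X : X \in m -> X \in g.
Proof. by apply/subvP/diffvSl. Qed.

Let u_sub X : X \in u -> X \in g.
Proof.
by apply/subvP; rewrite !subv_add; apply/and3P; split; apply/subvP=> Y;
  [apply: gh | apply: gv | apply: gc].
Qed.

Let c_sub_u X : X \in c -> X \in u.
Proof. by apply/subvP; rewrite /u addvA addvSr. Qed.

Lemma w_v x : x \in w -> x \in v.
Proof. by move=> /(subvP (diffvSl _ _)); rewrite memv_cap => /andP[]. Qed.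

Lemma beta_h x : beta x \in h.
Proof. exact: memv_pi1. Qed.

Lemma w_beta x : x \in w -> x - beta x \in c.
Proof.
move=> /(subvP (diffvSl _ _)); rewrite memv_cap => /andP[_].
exact: memv_sub_pi1.
Qed.

Lemma shift_center q x : q \in g -> x \in w -> shift q x \in c.
Proof.
move=> gq wx; rewrite memvD ?w_beta // bracket_center //.
exact: gv (w_v wx).
Qed.

Lemma bracket_beta q x : q \in g -> x \in w -> [br q, beta x] = [br q, x].
Proof.
move=> gq wx; have := br_center nilG gq (w_beta wx).
by rewrite brDr brNr => /eqP; rewrite subr_eq0 => /eqP.
Qed.

(** This identifies [shift q] with T_q: modulo c the factors exp x and exp (- beta x) cancel, and
    the central remainder is [shift q x]. *)
Lemma shift_conj q x : q \in g -> x \in w ->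
  mexp x *m mexp q *m mexp (- beta x) = mexp (q + shift q x).
Proof.
move=> gq wx; have gx := gv (w_v wx); have gb := gh (beta_h x).
have cxq := bracket_center gx gq.
rewrite (mexp_mul uniG nilG gx gq) (mexp_mul uniG nilG); last by rewrite memvN.
  rewrite brNr bracket_beta //; last by rewrite !memvD ?memvZ // gc.
  rewrite !brDl brZl (bracket_centerl cxq gx) brxx (br_anti q x) scaler0 /shift.
  by congr mexp; apply/matrixP=> i j; rewrite !mxE; field.
by rewrite !memvD ?memvZ // gc.
Qed.

(** If T_q x = p + r with p in v and r in h, both central, then Y = beta x + r lies in h and Y +
    [q, Y] = x - p in v. So Y = 0 by freeness, and x = p lies in c, which meets [w] trivially. *)
Lemma shift_inj q x : q \in g -> x \in w -> addv_pi1 c d (shift q x) = 0 -> x = 0.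
Proof.
move=> gq wx pi0; have cs := shift_center gq wx.
have : shift q x \in d.
  by rewrite -[shift q x]subr0 -pi0 memv_sub_pi1 // (subvP (addvSl _ _)).
move=> /memv_addP[p]; rewrite memv_cap => /andP[vp cp] [r].
rewrite memv_cap => /andP[hr cr] def_s.
have hY : beta x + r \in h by rewrite memvD ?beta_h.
have def_xp : beta x + r + [br q, beta x + r] = x - p.
  rewrite brDr bracket_beta // (br_center nilG gq cr) addr0 (br_anti q x).
  have -> : r = shift q x - p by rewrite def_s addrAC subrr add0r.
  by apply/matrixP=> i j; rewrite /shift !mxE; ring.
have Y0 : beta x + r = 0.
  by apply: (free_lie gq) => //; rewrite def_xp memvB // w_v.
move: def_xp; rewrite Y0 /lie_bracket mulmx0 mul0mx subrr addr0 => /esym/eqP.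
rewrite subr_eq0 => /eqP xp; apply/eqP; rewrite -memv0 -(capv_diff wv c).
by rewrite memv_cap wx xp cp.
Qed.

(** * The matrix of T_q and the count of dimensions *)

Let pi := addv_pi1 c d.

Definition shift_matrix (q : 'rV[F]_(\dim m)) : 'M[F]_(\dim w, \dim c') :=
  \matrix_(i, j) coord (vbasis c') j (pi (shift (lincomb q) (vbasis w)`_i)).

Lemma shift_matrix_affine q :
  shift_matrix q =
  (\matrix_(i, j) coord (vbasis c') j (pi ((vbasis w)`_i - beta (vbasis w)`_i)))
  + \sum_k q 0 k *:
      \matrix_(i, j) coord (vbasis c') j (pi [br (vbasis w)`_i, (vbasis m)`_k]).
Proof.
apply/matrixP=> i j; rewrite !mxE summxE /shift [pi _]linearD [LHS]linearD /=; congr (_ + _).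
rewrite /lincomb br_sumr !linear_sum; apply: eq_bigr => k _.
by rewrite brZr !linearZ /= !mxE.
Qed.

Lemma shift_matrixE q x :
  pi (shift (lincomb q) (lincomb x)) = lincomb (x *m shift_matrix q).
Proof.
rewrite -[LHS](@coordrowK _ _ c'); last exact: memv_pi1_diff.
congr lincomb; apply/rowP=> j; rewrite !mxE.
have -> : shift (lincomb q) (lincomb x) = \sum_i x 0 i *: shift (lincomb q) (vbasis w)`_i.
  rewrite /shift [lincomb x]/lincomb linear_sum br_suml -sumrB -big_split /=.
  by apply: eq_bigr => i _; rewrite linearZ /= brZl !scalerDr !scalerN.
by rewrite !linear_sum; apply: eq_bigr => i _; rewrite !linearZ /= !mxE.
Qed.

Let lincomb_g (q : 'rV[F]_(\dim m)) : lincomb q \in g := m_sub (lincomb_mem q).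

Lemma shift_matrix_free q : row_free (shift_matrix q).
Proof.
apply: inj_row_free => x x0; rewrite -[x](@lincombK _ _ w).
rewrite (@shift_inj (lincomb q) (lincomb x)) ?lincomb_mem ?lincomb_g //.
  by apply/rowP=> i; rewrite !mxE linear0.
by rewrite shift_matrixE x0 lincomb0.
Qed.

(** The dimension formula for v + (h + c), for h + c and for [d]; the last sum is direct because v
    and h meet trivially. *)
Lemma dim_u : (\dim u + \dim w = \dim v + \dim h + \dim c')%N.
Proof.
have wvc : (wv :&: c = v :&: c)%VS.
  by rewrite /wv -capvA (capv_idPr (addvSr h c)).
have vh_c0 : ((v :&: c) :&: (h :&: c) = 0)%VS.
  by apply/eqP; rewrite -subv0 -cap_lie capvS ?capvSl.
have eq_u : \dim u = \dim (v + (h + c)) by rewrite /u addvA (addvC h) -addvA.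
have := dimv_cap_compl wv c; rewrite wvc -/w.
have := dimv_sum_cap v (h + c); rewrite -/wv.
have := dimv_sum_cap h c.
have := dimv_cap_compl c d; rewrite (capv_idPr _) -/c'; last by apply/subvP.
have := dimv_sum_cap (v :&: c)%VS (h :&: c)%VS; rewrite vh_c0 dimv0 -/d eq_u.
lia.
Qed.

(** Together with dim w + k = dim c' it shows that the slice, with parameters in [m] and F^k, has
    dimension dim G - dim H - dim V. *)
Lemma dim_lie : (\dim g + \dim w = \dim m + \dim c' + \dim v + \dim h)%N.
Proof.
have := dimv_cap_compl g u; rewrite (capv_idPr _) -/m; last by apply/subvP.
have := dim_u; lia.
Qed.

(** * The slice and its parametrization *)

Variables (k : nat) (K : 'rV[F]_(\dim m) -> 'M[F]_(k, \dim c')).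
Variables (P : 'rV[F]_(\dim m) -> 'M[F]_(\dim c', \dim w)).
Variables (Q : 'rV[F]_(\dim m) -> 'M[F]_(\dim c', k)).
Hypotheses (polyK : polymap K) (polyP : polymap P) (polyQ : polymap Q).
Hypothesis (PMQK : forall q, P q *m shift_matrix q + Q q *m K q = 1%:M).
Hypothesis (MP : forall q, shift_matrix q *m P q = 1%:M).
Hypothesis (KQ : forall q, K q *m Q q = 1%:M).
Hypothesis (MQ : forall q, shift_matrix q *m Q q = 0).
Hypothesis (KP : forall q, K q *m P q = 0).

(** The rows of [K q] span a complement, in the coordinates of [c'], of the row space of
    [shift_matrix q], that is, of the image of T_q modulo [d]. *)
Definition slice_log q y : 'M[F]_n := lincomb q + lincomb (y *m K q).

Definition slice : set 'M[F]_n := [set A | exists q y, A = mexp (slice_log q y)].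

Definition slice_q A := coordrow m (addv_pi1 g u (mlog A)).

Definition slice_y A :=
  coordrow c' (pi (mlog A - lincomb (slice_q A))) *m Q (slice_q A).

Let lincomb_c' (z : 'rV[F]_(\dim c')) : lincomb z \in c := c'_sub (lincomb_mem z).

Lemma slice_log_mem q y : slice_log q y \in g.
Proof. by rewrite memvD ?lincomb_g // gc. Qed.

Lemma slice_sub A : slice A -> G A.
Proof. by move=> [q [y ->]]; apply: (lie_exp uniG (slice_log_mem q y)). Qed.

Lemma slice_qK q y : slice_q (mexp (slice_log q y)) = q.
Proof.
rewrite /slice_q (mlog_mexp uniG) ?slice_log_mem // /slice_log linearD /=.
rewrite addv_pi1_id ?lincomb_mem // addv_pi1_eq0 ?addr0 ?lincombK //.
exact: c_sub_u.
Qed.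

Lemma slice_yK q y : slice_y (mexp (slice_log q y)) = y.
Proof.
rewrite /slice_y slice_qK (mlog_mexp uniG) ?slice_log_mem // /slice_log.
rewrite addrAC subrr add0r /pi addv_pi1_id ?lincomb_mem // lincombK.
by rewrite -mulmxA KQ mulmx1.
Qed.

Lemma polymap_slice_q : polymap slice_q.
Proof.
apply: polymap_coordrow; apply: (polymap_comp (polymap_lfun _)).
exact: polymap_mlog.
Qed.

Lemma polymap_slice_y : polymap slice_y.
Proof.
apply: polymapM; last exact: (polymap_comp polyQ polymap_slice_q).
apply: polymap_coordrow; apply: (polymap_comp (polymap_lfun _)).
apply: polymapB; first exact: polymap_mlog.
exact: (polymap_lincomb polymap_slice_q).
Qed.

Lemma polymap_slice_exp (E : vectType F) (q : E -> 'rV[F]_(\dim m)) (y : E -> 'rV[F]_k) :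
  polymap q -> polymap y -> polymap (fun x => mexp (slice_log (q x) (y x))).
Proof.
move=> pq py; apply: (polymap_comp (@polymap_mexp _ _)); apply: polymapD.
  exact: polymap_lincomb.
by apply: polymap_lincomb; apply: polymapM => //; apply: (polymap_comp polyK pq).
Qed.

(** The slice is the set of fixed points in G of a polynomial retraction, which sends A to the
    exponential of [slice_log (slice_q A) (slice_y A)]. *)
Lemma slice_closed : zariski_closed slice.
Proof.
have -> : slice = G `&` [set A | mexp (slice_log (slice_q A) (slice_y A)) = A].
  apply/seteqP; split=> [A SA|A /= [_ <-]]; last by exists (slice_q A), (slice_y A).
  split; first exact: slice_sub.
  by case: SA => q [y ->] /=; rewrite slice_qK slice_yK.
apply: zariski_closed_eq.
- by apply: polymap_slice_exp; [apply: polymap_slice_q | apply: polymap_slice_y].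
- exact: polymap_id.
by case: uniG => -[].
Qed.

Lemma slice_affine : variety_isomorphic slice [set: 'rV[F]_(\dim m + k)].
Proof.
exists (fun A => row_mx (slice_q A) (slice_y A)); split.
  apply: polymap_regular => //; apply: polymap_entries => i j.
  under eq_fun do rewrite mxE; case: (splitP j) => l _.
    exact: (polyfun_entry_comp _ _ polymap_slice_q).
  exact: (polyfun_entry_comp _ _ polymap_slice_y).
exists (fun r => mexp (slice_log (lsubmx r) (rsubmx r))); split.
- apply: polymap_regular; last by move=> r _; exists (lsubmx r), (rsubmx r).
  apply: polymap_slice_exp; apply: polymap_entries => i j; under eq_fun do rewrite mxE;
  exact: polyfun_entry.
- by move=> _ [q [y ->]]; rewrite slice_qK slice_yK row_mxKl row_mxKr.
by move=> r _; rewrite slice_qK slice_yK hsubmxK.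
Qed.

(* The functions below factor A in G as
     exp a . exp rv . exp x . exp (q + z) . exp (- beta x) . exp rh . exp b,
   with a in v, b in h and q in m obtained modulo c, then x in w and z in the
   complement of the image of T_q modulo d, and rv, rh in the summands of d. *)
Definition part_a A := addv_pi1 v c (addv_pi2 h (v + c) (addv_pi2 g u (mlog A))).

Definition part_b A := addv_pi1 h (v + c) (addv_pi2 g u (mlog A)).

Definition center_part A :=
  mlog (mexp (- part_a A) *m A *m mexp (- part_b A)) - lincomb (slice_q A).

Definition part_coords A := coordrow c' (pi (center_part A)).

Definition part_x A := lincomb (part_coords A *m P (slice_q A)).

Definition part_y A := part_coords A *m Q (slice_q A).

Definition part_r A :=
  center_part A - shift (lincomb (slice_q A)) (part_x A)
    - lincomb (part_y A *m K (slice_q A)).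

Definition factor_V A :=
  mexp (part_a A) *m (mexp (addv_pi1 (v :&: c) (h :&: c) (part_r A)) *m mexp (part_x A)).

Definition factor_S A := mexp (slice_log (slice_q A) (part_y A)).

Definition factor_H A :=
  mexp (- beta (part_x A)) *m
    (mexp (addv_pi2 (v :&: c) (h :&: c) (part_r A)) *m mexp (part_b A)).

Lemma slice_qE A : lincomb (slice_q A) = addv_pi1 g u (mlog A).
Proof. by apply: coordrowK; apply: memv_pi1_diff. Qed.

Lemma part_a_v A : part_a A \in v.
Proof. exact: memv_pi1. Qed.

Lemma part_b_h A : part_b A \in h.
Proof. exact: memv_pi1. Qed.

Lemma part_x_w A : part_x A \in w.
Proof. exact: lincomb_mem. Qed.

Lemma factor_middle A : G A -> G (mexp (- part_a A) *m A *m mexp (- part_b A)).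
Proof.
move=> GA; have ga := gv (part_a_v A); have gb := gh (part_b_h A).
apply: (unipotentM uniG); first apply: (unipotentM uniG) => //;
  by apply: (lie_exp uniG); rewrite memvN.
Qed.

(** Modulo c the logarithm of a product is the sum of the logarithms, and [part_a], [part_b] and
    [slice_q] were chosen to exhaust log A modulo c; the brackets [B1] and [B2] are central. *)
Lemma center_part_c A : G A -> center_part A \in c.
Proof.
move=> GA; have ga := gv (part_a_v A); have gb := gh (part_b_h A).
have gL := lie_log uniG GA.
have split_u : mlog A = lincomb (slice_q A) + addv_pi2 g u (mlog A).
  by rewrite slice_qE addv_pi1_pi2 // (subvP (addvSl _ _)).
set Lu := addv_pi2 g u (mlog A) in split_u.
have split_b : Lu = part_b A + addv_pi2 h (v + c) Lu.
  by rewrite /part_b -/Lu addv_pi1_pi2 // memv_pi2.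
set Lvc := addv_pi2 h (v + c) Lu in split_b.
have split_a : Lvc = part_a A + addv_pi2 v c Lvc.
  by rewrite /part_a -/Lu -/Lvc addv_pi1_pi2 // memv_pi2.
rewrite /center_part.
move: (part_a A) (part_b A) (slice_q A) ga gb split_u split_b split_a.
move=> a b q ga gb split_u split_b split_a.
rewrite -(mexp_mlog uniG GA) (mexp_mul uniG nilG) ?memvN //.
set B1 := [br _, _]; have cB1 : B1 \in c by rewrite bracket_center ?memvN.
have gW : - a + mlog A + 2^-1 *: B1 \in g.
  by rewrite !memvD ?memvN ?memvZ // gc.
rewrite (mexp_mul uniG nilG) ?memvN //.
set B2 := [br _, _]; have cB2 : B2 \in c by rewrite bracket_center ?memvN.
have gW2 := gc cB2.
rewrite (mlog_mexp uniG); last by rewrite !memvD ?memvN ?memvZ // gc.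
rewrite [X in - a + X]split_u split_b split_a.
have -> : - a + (lincomb q + (b + (a + addv_pi2 v c Lvc)))
    + 2^-1 *: B1 - b + 2^-1 *: B2 - lincomb q
    = addv_pi2 v c Lvc + 2^-1 *: B1 + 2^-1 *: B2.
  by apply/matrixP=> i j; rewrite !mxE; ring.
by rewrite !memvD ?memvZ ?memv_pi2.
Qed.

(** The identity P M + Q K = 1 splits the class of [center_part] modulo [d] into a value of T_q and
    an element of the complement; [part_r] is what is left after subtracting both. *)
Lemma part_r_d A : G A -> part_r A \in d.
Proof.
move=> GA; have cz := center_part_c GA.
have cs : shift (lincomb (slice_q A)) (part_x A) \in c.
  by apply: shift_center; rewrite ?lincomb_g ?part_x_w.
suff -> : part_r A = (center_part A - pi (center_part A))
    - (shift (lincomb (slice_q A)) (part_x A)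
       - pi (shift (lincomb (slice_q A)) (part_x A))).
  by apply: memvB; apply: memv_sub_pi1; rewrite (subvP (addvSl _ _)).
have -> : pi (center_part A) = lincomb (part_coords A) by rewrite coordrowK // memv_pi1_diff.
have -> : lincomb (part_coords A)
    = lincomb (part_coords A *m P (slice_q A) *m shift_matrix (slice_q A))
    + lincomb (part_y A *m K (slice_q A)).
  by rewrite -lincombD /part_y -!mulmxA -mulmxDr PMQK mulmx1.
rewrite /part_r /part_x shift_matrixE.
by apply/matrixP=> i j; rewrite !mxE; ring.
Qed.

Lemma factor_mul A : G A -> factor_V A *m factor_S A *m factor_H A = A.
Proof.
move=> GA; have ga := gv (part_a_v A); have gb := gh (part_b_h A).
have gq := lincomb_g (slice_q A).
have dr := part_r_d GA.
set rv := addv_pi1 (v :&: c) (h :&: c) (part_r A).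
set rh := addv_pi2 (v :&: c) (h :&: c) (part_r A).
have def_r : rv + rh = part_r A by apply: addv_pi1_pi2.
have /andP[vrv crv] : (rv \in v) && (rv \in c) by rewrite -memv_cap memv_pi1.
have /andP[hrh crh] : (rh \in h) && (rh \in c) by rewrite -memv_cap memv_pi2.
have cz : lincomb (part_y A *m K (slice_q A)) \in c by [].
have gsl : slice_log (slice_q A) (part_y A) \in g := slice_log_mem _ _.
have sh_sl : shift (slice_log (slice_q A) (part_y A)) (part_x A)
    = shift (lincomb (slice_q A)) (part_x A).
  rewrite /shift /slice_log brDr (br_center nilG (gv (w_v (part_x_w A))) cz).
  by rewrite addr0.
have cs : shift (lincomb (slice_q A)) (part_x A) \in c.
  by apply: shift_center; rewrite ?part_x_w.
set sl := slice_log _ _ in gsl sh_sl *.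
have gmid : sl + shift (lincomb (slice_q A)) (part_x A) \in g by rewrite memvD // gc.
have grv := gc crv; have grh := gc crh.
(* After [shift_conj] the outer factors are central, so the exponents add up; by definition of
   [part_r] the sum is [center_part A] plus the component in [m]. *)
have mid : mexp rv *m (mexp (part_x A) *m mexp sl *m mexp (- beta (part_x A))) *m mexp rh
    = mexp (- part_a A) *m A *m mexp (- part_b A).
  rewrite shift_conj ?part_x_w // sh_sl.
  rewrite (mexp_mul_center uniG nilG) //; last exact: bracket_centerl.
  rewrite (mexp_mul_center uniG nilG) //; last first.
  - by apply: (br_center nilG) => //; rewrite memvD.
  - by rewrite memvD.
  rewrite -[RHS](mexp_mlog uniG (factor_middle GA)); congr mexp.
  rewrite -[mlog _](subrK (lincomb (slice_q A))) -/(center_part A).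
  have -> : rv + (sl + shift (lincomb (slice_q A)) (part_x A)) + rh
      = part_r A + sl + shift (lincomb (slice_q A)) (part_x A).
    by rewrite -def_r; apply/matrixP=> i j; rewrite !mxE; ring.
  by rewrite /part_r /sl /slice_log; apply/matrixP=> i j; rewrite !mxE; ring.
have -> : factor_V A *m factor_S A *m factor_H A
    = mexp (part_a A) *m (mexp (- part_a A) *m A *m mexp (- part_b A)) *m mexp (part_b A).
  by rewrite -mid /factor_V /factor_S /factor_H -/rv -/rh -/sl !mulmxA.
have Vb : mexp (- part_b A) *m mexp (part_b A) = 1%:M.
  by rewrite -{2}[part_b A]opprK (mexpV uniG nilG) // memvN.
by rewrite -!mulmxA Vb mulmx1 mulmxA (mexpV uniG nilG) // mul1mx.
Qed.

Lemma factor_V_mem A : G A -> V (factor_V A).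
Proof.
move=> GA; apply: (unipotentM uniV); last apply: (unipotentM uniV);
  apply: (lie_exp uniV).
- exact: part_a_v.
- by have := memv_pi1 (v :&: c) (h :&: c) (part_r A); rewrite memv_cap => /andP[].
- exact: w_v (part_x_w A).
Qed.

Lemma factor_H_mem A : G A -> H (factor_H A).
Proof.
move=> GA; apply: (unipotentM uniH); last apply: (unipotentM uniH);
  apply: (lie_exp uniH).
- by rewrite memvN beta_h.
- by have := memv_pi2 (v :&: c) (h :&: c) (part_r A); rewrite memv_cap => /andP[].
- exact: part_b_h.
Qed.

(** * Polynomiality of the factors *)

Lemma polymap_proj (E : vectType F) (f : E -> 'M[F]_n) (L : 'End('M[F]_n)) :
  polymap f -> polymap (fun x => L (f x)).
Proof. exact: (polymap_comp (polymap_lfun L)). Qed.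

Lemma polymap_mexp_comp (E : vectType F) (f : E -> 'M[F]_n) :
  polymap f -> polymap (fun x => mexp (f x)).
Proof. exact: (polymap_comp (@polymap_mexp _ _)). Qed.

Lemma polymap_part_a : polymap part_a.
Proof. by do 3![apply: polymap_proj]; apply: polymap_mlog. Qed.

Lemma polymap_part_b : polymap part_b.
Proof. by do 2![apply: polymap_proj]; apply: polymap_mlog. Qed.

Lemma polymap_center_part : polymap center_part.
Proof.
apply: polymapB; last exact: (polymap_lincomb polymap_slice_q).
apply: (polymap_comp (@polymap_mlog _ _)); apply: polymapM.
  apply: polymapM; last exact: polymap_id.
  by apply: polymap_mexp_comp; apply: polymapN; apply: polymap_part_a.
by apply: polymap_mexp_comp; apply: polymapN; apply: polymap_part_b.
Qed.

Lemma polymap_part_coords : polymap part_coords.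
Proof. by apply: polymap_coordrow; apply: polymap_proj; apply: polymap_center_part. Qed.

Lemma polymap_part_x : polymap part_x.
Proof.
apply: polymap_lincomb; apply: polymapM; first exact: polymap_part_coords.
exact: (polymap_comp polyP polymap_slice_q).
Qed.

Lemma polymap_part_y : polymap part_y.
Proof.
apply: polymapM; first exact: polymap_part_coords.
exact: (polymap_comp polyQ polymap_slice_q).
Qed.

Lemma polymap_part_r : polymap part_r.
Proof.
have px := polymap_part_x; have pq := polymap_lincomb polymap_slice_q.
apply: polymapB; last first.
  apply: polymap_lincomb; apply: polymapM; first exact: polymap_part_y.
  exact: (polymap_comp polyK polymap_slice_q).
apply: polymapB; first exact: polymap_center_part.
apply: polymapD; first by apply: polymapB => //; apply: polymap_proj.
by apply: polymapB; apply: polymapM.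
Qed.

Lemma polymap_factor_V : polymap factor_V.
Proof.
apply: polymapM; first by apply: polymap_mexp_comp; apply: polymap_part_a.
apply: polymapM; apply: polymap_mexp_comp; last exact: polymap_part_x.
by apply: polymap_proj; apply: polymap_part_r.
Qed.

Lemma polymap_factor_S : polymap factor_S.
Proof. by apply: polymap_slice_exp; [apply: polymap_slice_q | apply: polymap_part_y]. Qed.

Lemma polymap_factor_H : polymap factor_H.
Proof.
apply: polymapM.
  by apply: polymap_mexp_comp; apply: polymapN; apply: polymap_proj; apply: polymap_part_x.
apply: polymapM; apply: polymap_mexp_comp; last exact: polymap_part_b.
by apply: polymap_proj; apply: polymap_part_r.
Qed.

(** Modulo [u] the logarithms give q = q'. Then a + b is central, so a agrees modulo c with some x
    in [w], and b with - beta x; the slice components in c therefore differ by T_q x modulo [d],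
    hence not at all, lying in a complement of its image. *)
Lemma slice_unique a b q y q' y' : V a -> H b ->
  a *m mexp (slice_log q y) *m b = mexp (slice_log q' y') -> q = q' /\ y = y'.
Proof.
move=> Va Hb; have va := lie_log uniV Va; have hb := lie_log uniH Hb.
rewrite -(mexp_mlog uniG (VG Va)) -(mexp_mlog uniG (HG Hb)).
move: (mlog a) (mlog b) va hb => {Va Hb a b} a b va hb.
have ga := gv va; have gb := gh hb; have gs := slice_log_mem q y.
have gs' := slice_log_mem q' y'.
have cas := bracket_center ga gs.
rewrite (mexp_mul uniG nilG ga gs).
have gas : a + slice_log q y + 2^-1 *: [br a, slice_log q y] \in g.
  by rewrite !memvD ?memvZ // gc.
rewrite (mexp_mul uniG nilG gas gb).
have cbr := bracket_center gas gb.
move=> /(mexp_inj _ (lie_upper uniG gs')) eq_log.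
have {}eq_log := eq_log (lie_upper uniG _).
have {}eq_log : a + slice_log q y + 2^-1 *: [br a, slice_log q y] + b
    + 2^-1 *: [br a + slice_log q y + 2^-1 *: [br a, slice_log q y], b]
    = slice_log q' y'.
  by apply: eq_log; rewrite !memvD ?memvZ // gc.
set B1 := [br a, _] in cas gas cbr eq_log; set B2 := [br _, b] in cbr eq_log.
pose z := lincomb (y *m K q); pose z' := lincomb (y' *m K q').
have cz : z \in c by apply: lincomb_c'.
have cz' : z' \in c by apply: lincomb_c'.
have def_q : lincomb (q' - q) = a + b + (z + 2^-1 *: B1 + 2^-1 *: B2 - z').
  rewrite lincombB; move/eqP: eq_log; rewrite /slice_log -/z -/z' -subr_eq => /eqP <-.
  by apply/matrixP=> i j; rewrite !mxE; ring.
have uab : a + b + (z + 2^-1 *: B1 + 2^-1 *: B2 - z') \in u.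
  apply: memvD; last by apply: c_sub_u; rewrite !memvD ?memvN ?memvZ.
  apply: memvD; last exact: (subvP (addvSl _ _)).
  by apply: (subvP (addvSr _ _)); apply: (subvP (addvSl _ _)).
have qq' : q = q'.
  apply/eqP; rewrite eq_sym -subr_eq0; apply/eqP.
  rewrite -[LHS]lincombK -[lincomb _](@addv_pi1_id _ _ g u) ?lincomb_mem //.
  rewrite def_q addv_pi1_eq0 //.
  by apply/rowP=> i; rewrite !mxE linear0.
split=> //; subst q'; rewrite subrr lincomb0 in def_q.
have cab : a + b \in c.
  have -> : a + b = - (z + 2^-1 *: B1 + 2^-1 *: B2 - z').
    by apply/eqP; rewrite -addr_eq0 -def_q.
  by rewrite memvN !memvD ?memvN ?memvZ.
have wva : a \in wv.
  rewrite memv_cap va /= -[a](addrK b); apply: memvD.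
    exact: (subvP (addvSr _ _)).
  by apply: (subvP (addvSl _ _)); rewrite memvN.
pose x := addv_pi1 wv c a.
have wx : x \in w by apply: memv_pi1_diff.
have cax : a - x \in c by apply: memv_sub_pi1; apply: (subvP (addvSl _ _)).
have vax : a - x \in v by rewrite memvB // w_v.
have hbx : b + beta x \in h by rewrite memvD // beta_h.
have cbx : b + beta x \in c.
  have -> : b + beta x = (a + b) - (a - x) - (x - beta x).
    by apply/matrixP=> i j; rewrite !mxE; ring.
  by apply: memvB (w_beta wx); apply: memvB.
have gx := gv (w_v wx); have gq := lincomb_g q.
have def_B1 : B1 = [br x, lincomb q].
  rewrite /B1 -[a](subrK x) brDl (bracket_centerl cax gs) add0r.
  by rewrite /slice_log brDr (br_center nilG gx cz) addr0.
have def_B2 : B2 = [br x, lincomb q].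
  rewrite /B2 -[b](addrK (beta x)) brDr (br_center nilG gas cbx) add0r brNr.
  rewrite bracket_beta // !brDl brZl (bracket_centerl cas gx) scaler0 addr0.
  rewrite -[a](subrK x) brDl (bracket_centerl cax gx) brxx !add0r.
  by rewrite (bracket_centerl cz gx) addr0 br_anti opprK.
have dax : (a - x) + (b + beta x) \in d.
  by rewrite memv_add // memv_cap ?vax ?cax ?hbx ?cbx.
have def_z : lincomb (y' *m K q - y *m K q)
    = shift (lincomb q) x + ((a - x) + (b + beta x)).
  rewrite lincombB -/z -/z' /shift -[LHS]addr0 def_q def_B1 def_B2.
  by apply/matrixP=> i j; rewrite !mxE; field.
have /(congr1 pi) := def_z.
rewrite linearD /= [X in _ = _ + X]addv_pi1_eq0 // addr0.
rewrite -[x](@coordrowK _ _ w) // shift_matrixE /pi addv_pi1_id ?lincomb_mem //.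
(* Multiplication by [Q q] kills the image of T_q and recovers y' - y from its product with
   [K q]. *)
move=> /(congr1 (coordrow c')); rewrite !lincombK -mulmxBl => /(congr1 (mulmx^~ (Q q))).
rewrite -!mulmxA KQ MQ mulmx0 mulmx1 => /eqP; rewrite subr_eq0 => /eqP ->.
by [].
Qed.

Lemma slice_global : global_slice G V H slice.
Proof.
split; [exact: slice_sub | exact: slice_closed | split].
  apply: polymap_regular.
    apply: polymapM; last exact: polymap_snd.
    apply: polymapM.
      by apply: (polymap_comp (f := fst) (g := fst)); apply: polymap_fst.
    by apply: (polymap_comp (f := snd) (g := fst)); [apply: polymap_snd | apply: polymap_fst].
  move=> [[a s] b] [[/= Va Ss] Hb]; apply: (unipotentM uniG); last exact: HG.
  by apply: (unipotentM uniG); [apply: VG | apply: slice_sub].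
exists (fun A => (factor_V A, factor_S A, factor_H A)); split.
- apply: polymap_regular.
    apply: polymap_pair; last exact: polymap_factor_H.
    by apply: polymap_pair; [apply: polymap_factor_V | apply: polymap_factor_S].
  move=> A GA; split; [split=> /= | exact: factor_H_mem]; first exact: factor_V_mem.
  by exists (slice_q A), (part_y A).
- move=> [[a s] b] [[/= Va Ss] Hb].
  have Gs := slice_sub Ss.
  have GA : G (a *m s *m b).
    by apply: (unipotentM uniG); [apply: (unipotentM uniG); [apply: VG|]|apply: HG].
  have := factor_mul GA; set A := a *m s *m b in GA *.
  have := factor_V_mem GA; have := factor_H_mem GA; rewrite /factor_S.
  move: (factor_V A) (factor_H A) (slice_q A) (part_y A) => a' b' q' y' Hb' Va' def_A.
  have [[_ VM VI] _] := algV; have [[_ HM HI] _] := algH.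
  have [ua' Vi] := VI _ Va'; have [ub' Hi] := HI _ Hb'.
  have [q [y def_s]] := Ss.
  (* The computed factorization and the given one are compared: the two slice points lie in one
     orbit, so they agree, and freeness then identifies the factors in V and H. *)
  have eq_s : (invmx a' *m a) *m s *m (b *m invmx b') = mexp (slice_log q' y').
    transitivity (invmx a' *m A *m invmx b'); first by rewrite /A !mulmxA.
    by rewrite -def_A !mulmxA mulVmx // mul1mx mulmxK.
  have Va0 := VM _ _ Vi Va; have Hb0 := HM _ _ Hb Hi.
  have [q_q' y_y'] : q = q' /\ y = y'.
    by apply: slice_unique Va0 Hb0 _; rewrite -def_s.
  have ss' : mexp (slice_log q' y') = s by rewrite -q_q' -y_y' def_s.
  have [ub0 Hb0i] := HI _ Hb0.
  have [|a1 b1] := freeVH Va0 Hb0i Gs; first by rewrite invmxK eq_s ss'.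
  have -> : a' = a by rewrite -[a](mulKVmx ua') a1 mulmx1.
  have b01 : b *m invmx b' = 1%:M by rewrite -[LHS]invmxK b1 invmx1.
  have -> : b' = b by rewrite -[b](mulmxKV ub') b01 mul1mx.
  by rewrite ss'.
by move=> A GA /=; apply: factor_mul.
Qed.

End Slice.

(** * Existence of the slice *)

Theorem exists_affine_slice (F : numClosedFieldType) (n : nat) (G V H : set 'M[F]_n)
    (uniG : unipotent_group G) (nilG : step_nilpotent 2 (lie_algebra G))
    (algV : algebraic_group V) (VG : V `<=` G)
    (algH : algebraic_group H) (HG : H `<=` G) (freeVH : free_action G V H) :
  (group_dim H + group_dim V <= group_dim G)%N /\
  exists S : set 'M[F]_n, global_slice G V H S /\
    variety_isomorphic S [set: 'rV[F]_(group_dim G - group_dim H - group_dim V)%N].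
Proof.
have dims := dim_lie uniG nilG algV VG algH HG freeVH.
have [k [K [P [Q [[rk polyK polyP polyQ] KPQ]]]]] := linear_family_completion
  (shift_matrix_affine (n := n) (G := G) (V := V) (H := H))
  (shift_matrix_free uniG nilG algV VG algH HG freeVH).
have dim_eq : (group_dim G - group_dim H - group_dim V =
    \dim (lie_algebra G :\: (lie_algebra H + (lie_algebra V +
      lie_prod (lie_algebra G) (lie_algebra G)))) + k)%N.
  by rewrite /group_dim; lia.
split; first by rewrite /group_dim; lia.
rewrite dim_eq; exists (slice K); split.
  by apply: (slice_global uniG nilG algV VG algH HG freeVH polyK polyP polyQ) => q;
    case: (KPQ q).
by apply: (slice_affine uniG nilG polyK polyQ) => q; case: (KPQ q).
Qed.

Theorem proposition2 (R : realType) (n : nat) (G V H : set 'M[R[i]]_n)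
    (hG : unipotent_group G)
    (hGconn : connected (G : set 'M[R[i]^o]_n))
    (hGsc : simply_connected R (G : set 'M[R[i]^o]_n))
    (hV : algebraic_group V) (hVG : V `<=` G)
    (hH : algebraic_group H) (hHG : H `<=` G)
    (hfree : free_action G V H)
    (hnil : step_nilpotent 2 (lie_algebra G)) :
  (group_dim H + group_dim V <= group_dim G)%N /\
  exists S : set 'M[R[i]]_n,
    global_slice G V H S /\
    variety_isomorphic S
      [set: 'rV[R[i]]_(group_dim G - group_dim H - group_dim V)%N].
Proof. exact: exists_affine_slice. Qed.
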